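(* Let $t=\prod_{i=1}^4(1+\omega_i+\cdots+\omega_i^{\ell-1})$ and $x=E_{\beta_{24}}^{\ell-1}E_{\beta_{23}}^{\ell-1}\cdots E_{\beta_1}^{\ell-1}$. Then $y=tx$ (respectively $y'=xt$) is a left (respectively right) integral in $\mathfrak{b}$.
   Context: An element $y$ of a finite-dimensional Hopf algebra $H$ is a left (resp. right) integral if $ay=\varepsilon(a)y$ (resp. $ya=\varepsilon(a)y$) for all $a\in H$. Let $r$ be a primitive $d$-th root of unity, $s$ a primitive $d'$-th root of unity, $\ell=\mathrm{lcm}(d,d')$, with $\ell$ odd and $r^2\neq s^2$, $r^3\neq s^3$. Let $\mathbb{K}=\mathbb{Q}(r,s)\subset\mathbb{C}$ (it contains a primitive $\ell$-th root of unity). Put $r_1=r_2=r^2$, $r_3=r_4=r$, $s_1=s_2=s^2$, $s_3=s_4=s$ and $$(a_{ij})_{4\times 4}=\begin{pmatrix} r^2s^{-2}&s^2&1&1\\ r^{-2}&r^2s^{-2}&s^2&1\\ 1&r^{-2}&rs^{-1}&s\\ 1&1&r^{-1}&rs^{-1}\end{pmatrix}.$$ $U_{r,s}(F_4)$ is the unital associative $\mathbb{K}$-algebra generated by $E_i,F_i,\omega_i^{\pm1},\omega_i'^{\pm1}$ ($1\le i\le4$) with relations: all $\omega_i^{\pm1},\omega_j'^{\pm1}$ commute, $\omega_i\omega_i^{-1}=1=\omega_i'\omega_i'^{-1}$; $\omega_iE_j\omega_i^{-1}=a_{ij}E_j$, $\omega_iF_j\omega_i^{-1}=a_{ij}^{-1}F_j$;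 $\omega_i'E_j\omega_i'^{-1}=a_{ji}^{-1}E_j$, $\omega_i'F_j\omega_i'^{-1}=a_{ji}F_j$; $E_iF_j-F_jE_i=\delta_{ij}\frac{\omega_i-\omega_i'}{r_i-s_i}$; and the $(r,s)$-Serre relations: $E_iE_j=E_jE_i$, $F_iF_j=F_jF_i$ for $|i-j|\ge2$, $E_1^2E_2-(r^2+s^2)E_1E_2E_1+r^2s^2E_2E_1^2=0$; $E_2^2E_1-(r^{-2}+s^{-2})E_2E_1E_2+r^{-2}s^{-2}E_1E_2^2=0$; $E_2^2E_3-(r^2+s^2)E_2E_3E_2+r^2s^2E_3E_2^2=0$; $E_3^3E_2-(r^{-2}+r^{-1}s^{-1}+s^{-2})E_3^2E_2E_3+r^{-1}s^{-1}(r^{-2}+r^{-1}s^{-1}+s^{-2})E_3E_2E_3^2-r^{-3}s^{-3}E_2E_3^3=0$; $E_3^2E_4-(r+s)E_3E_4E_3+rsE_4E_3^2=0$; $E_4^2E_3-(r^{-1}+s^{-1})E_4E_3E_4+r^{-1}s^{-1}E_3E_4^2=0$; together with the six relations obtained from these by replacing each $E_i$ by $F_i$ and reversing the order of the factors in every monomial, with the same coefficients. It is a Hopf algebra with $\omega_i^{\pm1},\omega_i'^{\pm1}$ group-like, $\Delta(E_i)=E_i\otimes1+\omega_i\otimes E_i$, $\Delta(F_i)=1\otimes F_i+F_i\otimes\omega_i'$, $\varepsilon(E_i)=\varepsilon(F_i)=0$, $S(E_i)=-\omega_i^{-1}E_i$, $S(F_i)=-F_i\omega_i'^{-1}$. For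 $\zeta=\sum\zeta_i\alpha_i$, $\eta=\sum\eta_i\alpha_i$ in the root lattice put $\langle\omega_\eta',\omega_\zeta\rangle=\prod_{i,j}a_{ij}^{\zeta_i\eta_j}$. For $x,y$ in the subalgebra $\langle E_1,\dots,E_4\rangle$ of degrees $\zeta,\eta$ (with $\deg E_i=\alpha_i$), $[x,y]=xy-\langle\omega_\eta',\omega_\zeta\rangle yx$. The 24 positive roots of type $F_4$ are ordered as $\beta_1<\dots<\beta_{24}$; $\beta_k$ is the sum of $\alpha_c$ over the letters $c$ of the word $u_k$, where $u_1,\dots,u_{24}$ are: $1$; $12$; $123$; $1233$; $12332$; $1234$; $12343$; $12343123432$; $123432$; $1234323$; $123434$; $1234342$; $12343423$; $123434233$; $1234342332$; $2$; $23$; $233$; $234$; $2343$; $23434$; $3$; $34$; $4$. Quantum root vectors: $E_{\beta_1}=E_1$, $E_{\beta_{16}}=E_2$, $E_{\beta_{22}}=E_3$, $E_{\beta_{24}}=E_4$, and otherwise $E_{\beta_k}=[E_{\beta_i},E_{\beta_j}]$ with $k=(i,j)$: $2=(1,16)$, $3=(2,22)$, $4=(3,22)$, $5=(4,16)$, $6=(3,24)$, $7=(6,22)$, $9=(7,16)$, $8=(7,9)$, $10=(9,22)$, $11=(7,24)$, $12=(11,16)$, $13=(12,22)$, $14=(13,22)$, $15=(14,16)$, $17=(16,22)$, $18=(17,22)$, $19=(17,24)$, $20=(19,22)$, $21=(20,24)$, $23=(22,24)$. Also $F_{\beta_1}=F_1$, $F_{\beta_{16}}=F_2$, $F_{\beta_{22}}=F_3$,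 $F_{\beta_{24}}=F_4$ and $F_{\beta_k}=F_{\beta_j}F_{\beta_i}-\langle\omega_{\beta_i}',\omega_{\beta_j}\rangle^{-1}F_{\beta_i}F_{\beta_j}$ for the same pairs $k=(i,j)$. $\mathfrak{u}_{r,s}(F_4)=U_{r,s}(F_4)/\mathcal{I}$, where $\mathcal{I}$ is the two-sided ideal (a Hopf ideal) generated by $E_{\beta_i}^\ell,F_{\beta_i}^\ell$ ($1\le i\le24$) and $\omega_k^\ell-1,\omega_k'^{\,\ell}-1$ ($1\le k\le4$). $\mathfrak{b}$ is the Hopf subalgebra of $\mathfrak{u}_{r,s}(F_4)$ generated by $E_i,\omega_i^{\pm1}$ ($1\le i\le4$). *)

(* Defs.v *)
From HB Require Import structures.
From mathcomp Require Import all_boot all_order all_algebra all_field.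
From mathcomp Require Import generic_quotient ring_quotient.
From mathcomp Require Import finmap monalg.
From mathcomp Require Import boolp.

Set Implicit Arguments.
Unset Strict Implicit.
Unset Printing Implicit Defensive.

Import Order.TTheory GRing.Theory Num.Theory.
Local Open Scope ring_scope.
Local Open Scope quotient_scope.

(* Some constants below are locked to keep unification from unfolding them. *)
Fact alg_key : unit. Proof. exact: tt. Qed.

Definition freeAlg (K : fieldType) (X : choiceType) : Type :=
  {malg K[{fmonom X}]}.

Section FreeAlg.
Variables (K : fieldType) (X : choiceType).

HB.instance Definition _ := GRing.Lalgebra.on (freeAlg K X).

Lemma freeAlg_scaleU (k c : K) (m : {fmonom X}) :
  k *: << c *g m >> = << k * c *g m >> :> {malg K[{fmonom X}]}.
Proof. by apply/malgP => q; rewrite mcoeffZ !mcoeffU mulrnAr. Qed.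

Fact freeAlg_scalerAr (k : K) (x y : freeAlg K X) :
  k *: (x * y) = x * (k *: y).
Proof.
rewrite (monalgE y) mulr_sumr !scaler_sumr mulr_sumr; apply: eq_bigr => m _.
rewrite (monalgE x) !mulr_suml scaler_sumr; apply: eq_bigr => m' _.
by rewrite !malgM_def fgmulUU !freeAlg_scaleU fgmulUU mulrCA.
Qed.

HB.instance Definition _ :=
  GRing.Lalgebra_isAlgebra.Build K (freeAlg K X) freeAlg_scalerAr.

Definition freeVar : X -> freeAlg K X :=
  locked_with alg_key (fun x => << fmu x >>).

Section Eval.
Variables (B : algType K) (f : X -> B).

Definition freeEval (p : freeAlg K X) : B :=
  mmap (in_alg B) (fun m : {fmonom X} => \prod_(x <- m) f x) p.

Fact freeEval_is_additive : zmod_morphism freeEval.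
Proof. exact: mmap_is_additive. Qed.

Lemma freeEvalU c m : freeEval << c *g m >> = c *: \prod_(x <- m) f x.
Proof. by rewrite /freeEval mmapU /= -scalerAl mul1r. Qed.

HB.instance Definition _ :=
  GRing.isZmodMorphism.Build (freeAlg K X) B freeEval freeEval_is_additive.

Let freeEval_sumE p : freeEval p = \sum_(m <- msupp p) p@_m *: freeEval << m >>.
Proof.
rewrite [in LHS](monalgE p) (raddf_sum freeEval); apply: eq_bigr => m _.
by rewrite freeEvalU scale1r [LHS]freeEvalU.
Qed.

Fact freeEval_is_scalable : scalable freeEval.
Proof.
move=> k p; rewrite (freeEval_sumE p) scaler_sumr [in LHS](monalgE p).
rewrite scaler_sumr (raddf_sum freeEval); apply: eq_bigr => m _.
rewrite freeAlg_scaleU.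
by rewrite freeEvalU scale1r scalerA [LHS]freeEvalU.
Qed.

HB.instance Definition _ :=
  GRing.isScalable.Build K (freeAlg K X) B *:%R freeEval freeEval_is_scalable.

Fact freeEval_is_monoid_morphism : monoid_morphism freeEval.
Proof.
split.
  by rewrite -[LHS]/(freeEval << 1 *g @mone {fmonom X} >>) freeEvalU fm1 big_nil scale1r.
move=> p q; rewrite (freeEval_sumE p) mulr_suml [in LHS](monalgE p).
rewrite mulr_suml (raddf_sum freeEval); apply: eq_bigr => m _.
rewrite (freeEval_sumE q) mulr_sumr [in LHS](monalgE q).
rewrite mulr_sumr (raddf_sum freeEval); apply: eq_bigr => m' _.
rewrite !freeEvalU !scale1r -[LHS]/(freeEval _) malgM_def fgmulUU [LHS]freeEvalU.
by rewrite fmM big_cat /= -scalerAl -scalerAr scalerA.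
Qed.

HB.instance Definition _ :=
  GRing.isMonoidMorphism.Build (freeAlg K X) B freeEval
    freeEval_is_monoid_morphism.

Lemma freeEval_var x : freeEval (freeVar x) = f x.
Proof. by rewrite /freeVar locked_withE freeEvalU fmU big_seq1 scale1r. Qed.

Definition freeAntiEval (p : freeAlg K X) : B :=
  mmap (in_alg B) (fun m : {fmonom X} => \prod_(x <- rev m) f x) p.

Fact freeAntiEval_is_additive : zmod_morphism freeAntiEval.
Proof. exact: mmap_is_additive. Qed.

Lemma freeAntiEvalU c m :
  freeAntiEval << c *g m >> = c *: \prod_(x <- rev m) f x.
Proof. by rewrite /freeAntiEval mmapU /= -scalerAl mul1r. Qed.

HB.instance Definition _ :=
  GRing.isZmodMorphism.Build (freeAlg K X) B freeAntiEval
    freeAntiEval_is_additive.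

Let freeAntiEval_sumE p : freeAntiEval p = \sum_(m <- msupp p) p@_m *: freeAntiEval << m >>.
Proof.
rewrite [in LHS](monalgE p) (raddf_sum freeAntiEval); apply: eq_bigr => m _.
by rewrite freeAntiEvalU scale1r [LHS]freeAntiEvalU.
Qed.

Fact freeAntiEval_is_scalable : scalable freeAntiEval.
Proof.
move=> k p; rewrite (freeAntiEval_sumE p) scaler_sumr [in LHS](monalgE p).
rewrite scaler_sumr (raddf_sum freeAntiEval); apply: eq_bigr => m _.
rewrite freeAlg_scaleU.
by rewrite freeAntiEvalU scale1r scalerA [LHS]freeAntiEvalU.
Qed.

HB.instance Definition _ :=
  GRing.isScalable.Build K (freeAlg K X) B *:%R freeAntiEval
    freeAntiEval_is_scalable.

Lemma freeAntiEval1 : freeAntiEval 1 = 1.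
Proof. by rewrite -[LHS]/(freeAntiEval << 1 *g @mone {fmonom X} >>) freeAntiEvalU fm1 big_nil scale1r. Qed.

Lemma freeAntiEvalM p q :
  freeAntiEval (p * q) = freeAntiEval q * freeAntiEval p.
Proof.
rewrite (freeAntiEval_sumE p) mulr_sumr [in LHS](monalgE p).
rewrite mulr_suml (raddf_sum freeAntiEval); apply: eq_bigr => m _.
rewrite (freeAntiEval_sumE q) mulr_suml [in LHS](monalgE q).
rewrite mulr_sumr (raddf_sum freeAntiEval); apply: eq_bigr => m' _.
rewrite !freeAntiEvalU !scale1r -[LHS]/(freeAntiEval _) malgM_def fgmulUU [LHS]freeAntiEvalU.
by rewrite fmM rev_cat big_cat /= -scalerAl -scalerAr scalerA mulrC.
Qed.

Lemma freeAntiEval_var x : freeAntiEval (freeVar x) = f x.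
Proof.
by rewrite /freeVar locked_withE freeAntiEvalU fmU big_seq1 scale1r.
Qed.

End Eval.
End FreeAlg.

Arguments freeVar {K X}.

(* Algebras are nonzero rings in ssralg, so only quotients by ideals generated
   by elements of the augmentation ideal are formed; such a quotient is nonzero
   and augmented again. *)

Inductive ideal_gen (A : nzRingType) (G : A -> Prop) : A -> Prop :=
| Ideal0 : ideal_gen G 0
| IdealG a g b : G g -> ideal_gen G (a * g * b)
| IdealD x y : ideal_gen G x -> ideal_gen G y -> ideal_gen G (x + y).

Section AugQuotient.
Variables (K : fieldType) (A : algType K) (eps : {lrmorphism A -> K^o}).
Variables (G : A -> Prop) (G_eps : forall g, G g -> eps g = 0).

Definition idealb : {pred A} := fun x => `[< ideal_gen G x >].

Lemma idealbP x : reflect (ideal_gen G x) (x \in idealb).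
Proof. exact: asboolP. Qed.

Lemma ideal_genMl a x : ideal_gen G x -> ideal_gen G (a * x).
Proof.
elim=> [|b g c Gg|y z _ Iy _ Iz]; first by rewrite mulr0; apply: Ideal0.
  by rewrite !mulrA; apply: IdealG.
by rewrite mulrDr; apply: IdealD.
Qed.

Lemma ideal_genMr a x : ideal_gen G x -> ideal_gen G (x * a).
Proof.
elim=> [|b g c Gg|y z _ Iy _ Iz]; first by rewrite mul0r; apply: Ideal0.
  by rewrite -mulrA; apply: IdealG.
by rewrite mulrDl; apply: IdealD.
Qed.

Lemma ideal_rel x : G x -> ideal_gen G x.
Proof. by move=> Gx; rewrite -[x]mul1r -[1 * x]mulr1; apply: IdealG. Qed.

Lemma ideal_gen_eps x : ideal_gen G x -> eps x = 0.
Proof.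
elim=> [|a g b /G_eps eg|y z _ ey _ ez]; first exact: raddf0.
  by rewrite !rmorphM /= eg mulr0 mul0r.
by rewrite raddfD /= ey ez addr0.
Qed.

Fact idealb_zmod_closed : zmod_closed idealb.
Proof.
split=> [|x y /idealbP Ix /idealbP Iy]; first exact/idealbP/Ideal0.
by apply/idealbP/IdealD => //; rewrite -mulN1r; apply: ideal_genMl.
Qed.

HB.instance Definition _ := GRing.isZmodClosed.Build A idealb idealb_zmod_closed.

(* G_eps is kept as a phantom argument: it makes the quotient nonzero. *)
Definition augQuot of (forall g, G g -> eps g = 0) : Type :=
  Quotient.quot (idealb : zmodClosed A).
Local Notation Q := (augQuot G_eps).

HB.instance Definition _ := GRing.Zmodule.on Q.
HB.instance Definition _ :=
  EqQuotient.copy Q (Quotient.quot (idealb : zmodClosed A)).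

Definition augPi : A -> Q := locked_with alg_key (fun x => \pi_Q x).

Lemma augPiE x : augPi x = \pi_Q x.
Proof. by rewrite /augPi locked_withE. Qed.

Lemma augPiP x y : augPi x = augPi y <-> ideal_gen G (x - y).
Proof.
rewrite !augPiE (rwP (idealbP (x - y))).
rewrite -[_ \in idealb]/(Quotient.equiv (idealb : zmodClosed A) x y).
split=> [/eqP|] h; last by apply/eqP; rewrite piE.
by move: h; rewrite piE.
Qed.

Lemma augPi_surj (q : Q) : augPi (repr q) = q.
Proof. by rewrite augPiE; apply: reprK. Qed.

Fact augPi_is_additive : zmod_morphism augPi.
Proof.
move=> x y; rewrite !augPiE; apply: etrans (Quotient.pi_add _ _ _) _.
by congr (_ + _); apply: Quotient.pi_opp.
Qed.
HB.instance Definition _ :=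
  GRing.isZmodMorphism.Build A Q augPi augPi_is_additive.

Lemma augPi_repr x : ideal_gen G (repr (augPi x) - x).
Proof. by apply/augPiP; rewrite augPi_surj. Qed.

Definition augOne : Q := locked_with alg_key (augPi 1).
Definition augMul : Q -> Q -> Q :=
  locked_with alg_key (fun x y => augPi (repr x * repr y)).
Definition augScale : K -> Q -> Q :=
  locked_with alg_key (fun k x => augPi (k *: repr x)).

Lemma augOneE : augOne = augPi 1.
Proof. by rewrite /augOne locked_withE. Qed.

Lemma augMulE x y : augMul (augPi x) (augPi y) = augPi (x * y).
Proof.
rewrite /augMul locked_withE; apply/augPiP.
have -> : repr (augPi x) * repr (augPi y) - x * y =
  (repr (augPi x) - x) * repr (augPi y) + x * (repr (augPi y) - y).
  by rewrite mulrBl mulrBr addrA subrK.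
by apply: IdealD; [apply: ideal_genMr|apply: ideal_genMl]; apply: augPi_repr.
Qed.

Lemma augScaleE k x : augScale k (augPi x) = augPi (k *: x).
Proof.
rewrite /augScale locked_withE; apply/augPiP; rewrite -scalerBr -[X in k *: X]mul1r scalerAl.
exact/ideal_genMl/augPi_repr.
Qed.

Lemma augPi_ind (P : Q -> Prop) : (forall x, P (augPi x)) -> forall q, P q.
Proof. by move=> h q; rewrite -[q]augPi_surj. Qed.

Fact augMulA : associative augMul.
Proof.
by do 3![elim/augPi_ind=> ?]; rewrite !augMulE mulrA.
Qed.
Fact augMul1 : left_id augOne augMul.
Proof. by elim/augPi_ind=> x; rewrite augOneE augMulE mul1r. Qed.
Fact augMulr1 : right_id augOne augMul.
Proof. by elim/augPi_ind=> x; rewrite augOneE augMulE mulr1. Qed.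
Fact augMulDl : left_distributive augMul +%R.
Proof.
by do 3![elim/augPi_ind=> ?]; rewrite -raddfD !augMulE -raddfD mulrDl.
Qed.
Fact augMulDr : right_distributive augMul +%R.
Proof.
by do 3![elim/augPi_ind=> ?]; rewrite -raddfD !augMulE -raddfD mulrDr.
Qed.
Fact augOne_neq0 : augOne != 0.
Proof.
apply/eqP; rewrite augOneE -(raddf0 augPi) => /augPiP /ideal_gen_eps.
by rewrite subr0 rmorph1 => /eqP; rewrite oner_eq0.
Qed.

HB.instance Definition _ := GRing.Zmodule_isNzRing.Build Q
  augMulA augMul1 augMulr1 augMulDl augMulDr augOne_neq0.

Fact augScaleA a b v : augScale a (augScale b v) = augScale (a * b) v.
Proof. by elim/augPi_ind: v => v; rewrite !augScaleE scalerA. Qed.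
Fact augScale1 : left_id 1 augScale.
Proof. by elim/augPi_ind=> v; rewrite augScaleE scale1r. Qed.
Fact augScaleDr : right_distributive augScale +%R.
Proof.
by move=> k; do 2![elim/augPi_ind=> ?]; rewrite -raddfD !augScaleE -raddfD scalerDr.
Qed.
Fact augScaleDl v : {morph augScale^~ v : a b / a + b}.
Proof. by move=> a b; elim/augPi_ind: v => v; rewrite !augScaleE -raddfD scalerDl. Qed.

HB.instance Definition _ := GRing.Zmodule_isLmodule.Build K Q
  augScaleA augScale1 augScaleDr augScaleDl.

Fact augScaleAl (k : K) (x y : Q) : k *: (x * y) = (k *: x) * y.
Proof.
elim/augPi_ind: x => x; elim/augPi_ind: y => y.
rewrite -[LHS]/(augScale k (augMul _ _)) -[RHS]/(augMul (augScale _ _) _).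
by rewrite augMulE !augScaleE augMulE scalerAl.
Qed.
HB.instance Definition _ := GRing.Lmodule_isLalgebra.Build K Q augScaleAl.

Fact augScaleAr (k : K) (x y : Q) : k *: (x * y) = x * (k *: y).
Proof.
elim/augPi_ind: x => x; elim/augPi_ind: y => y.
rewrite -[LHS]/(augScale k (augMul _ _)) -[RHS]/(augMul _ (augScale _ _)).
by rewrite augMulE !augScaleE augMulE scalerAr.
Qed.
HB.instance Definition _ := GRing.Lalgebra_isAlgebra.Build K Q augScaleAr.

Fact augPi_is_monoid_morphism : monoid_morphism augPi.
Proof. by split=> [|x y]; rewrite -?augMulE // -augOneE. Qed.
HB.instance Definition _ :=
  GRing.isMonoidMorphism.Build A Q augPi augPi_is_monoid_morphism.

Fact augPi_is_scalable : scalable augPi.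
Proof. by move=> k x; rewrite -augScaleE. Qed.
HB.instance Definition _ :=
  GRing.isScalable.Build K A Q *:%R augPi augPi_is_scalable.

Definition augEps (q : Q) : K^o := eps (repr q).

Lemma augEpsE x : augEps (augPi x) = eps x.
Proof.
apply/eqP; rewrite -subr_eq0 -raddfB; apply/eqP.
exact/ideal_gen_eps/augPi_repr.
Qed.

Fact augEps_is_additive : zmod_morphism augEps.
Proof.
by do 2![elim/augPi_ind=> ?]; rewrite -raddfB !augEpsE raddfB.
Qed.
HB.instance Definition _ :=
  GRing.isZmodMorphism.Build Q K^o augEps augEps_is_additive.

Fact augEps_is_monoid_morphism : monoid_morphism augEps.
Proof.
split.
  by rewrite -[1](rmorph1 augPi) augEpsE rmorph1.
by do 2![elim/augPi_ind=> ?]; rewrite -rmorphM !augEpsE rmorphM.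
Qed.
HB.instance Definition _ :=
  GRing.isMonoidMorphism.Build Q K^o augEps augEps_is_monoid_morphism.

Fact augEps_is_scalable : scalable augEps.
Proof. by move=> k; elim/augPi_ind=> x; rewrite -linearZ !augEpsE linearZ. Qed.
HB.instance Definition _ :=
  GRing.isScalable.Build K Q K^o *:%R augEps augEps_is_scalable.

End AugQuotient.

(* A (x) B is presented as the algebra generated by commuting homomorphic
   copies of A and B; tens a b is the pure tensor of a and b. *)

Section Tensor.
Variables (K : fieldType) (A B : algType K).
Variables (epsA : {lrmorphism A -> K^o}) (epsB : {lrmorphism B -> K^o}).

Let T := freeAlg K (A + B)%type.
Let vl (a : A) : T := freeVar (inl a).
Let vr (b : B) : T := freeVar (inr b).

Inductive tensor_rel : T -> Prop :=
| TensLlin k a a' : tensor_rel (vl (k *: a + a') - (k *: vl a + vl a'))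
| TensLmul a a' : tensor_rel (vl (a * a') - vl a * vl a')
| TensLone : tensor_rel (vl 1 - 1)
| TensRlin k b b' : tensor_rel (vr (k *: b + b') - (k *: vr b + vr b'))
| TensRmul b b' : tensor_rel (vr (b * b') - vr b * vr b')
| TensRone : tensor_rel (vr 1 - 1)
| TensComm a b : tensor_rel (vl a * vr b - vr b * vl a).

Definition tensor_free_eps : T -> K^o :=
  freeEval (fun x : (A + B)%type =>
    match x return K^o with inl a => epsA a | inr b => epsB b end).
HB.instance Definition _ := GRing.LRMorphism.on tensor_free_eps.

Fact tensor_rel_eps g : tensor_rel g -> tensor_free_eps g = 0.
Proof.
have El a : tensor_free_eps (vl a) = epsA a by apply: freeEval_var.
have Er b : tensor_free_eps (vr b) = epsB b by apply: freeEval_var.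
case=> [k a a'|a a'||k b b'|b b'||a b]; 
  rewrite raddfB; apply/eqP; rewrite subr_eq0; apply/eqP; rewrite /=.
- by rewrite [RHS]linearP /= !El linearP.
- by rewrite [RHS]rmorphM /= !El rmorphM.
- by rewrite [RHS]rmorph1 El rmorph1.
- by rewrite [RHS]linearP /= !Er linearP.
- by rewrite [RHS]rmorphM /= !Er rmorphM.
- by rewrite [RHS]rmorph1 Er rmorph1.
- apply: etrans (rmorphM _ _ _) _; apply: etrans _ (esym (rmorphM _ _ _)).
  exact: mulrC.
Qed.

Definition tensor : algType K := augQuot tensor_rel_eps.
Definition tens (a : A) (b : B) : tensor := augPi tensor_rel_eps (vl a * vr b).

Definition tensL (a : A) : tensor := augPi tensor_rel_eps (vl a).
Definition tensR (b : B) : tensor := augPi tensor_rel_eps (vr b).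

Lemma tensE a b : tens a b = tensL a * tensR b.
Proof. exact: (rmorphM (augPi tensor_rel_eps)). Qed.

Let tens_rel_eq x y : tensor_rel (x - y) ->
  augPi tensor_rel_eps x = augPi tensor_rel_eps y.
Proof. by move=> h; apply/augPiP; apply: ideal_rel. Qed.

Lemma tensLM a a' : tensL (a * a') = tensL a * tensL a'.
Proof.
apply: etrans (tens_rel_eq (TensLmul a a')) _.
exact: (rmorphM (augPi tensor_rel_eps)).
Qed.

Lemma tensRM b b' : tensR (b * b') = tensR b * tensR b'.
Proof.
apply: etrans (tens_rel_eq (TensRmul b b')) _.
exact: (rmorphM (augPi tensor_rel_eps)).
Qed.

Lemma tensL1 : tensL 1 = 1.
Proof.
apply: etrans (tens_rel_eq TensLone) _.
exact: (rmorph1 (augPi tensor_rel_eps)).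
Qed.

Lemma tensR1 : tensR 1 = 1.
Proof.
apply: etrans (tens_rel_eq TensRone) _.
exact: (rmorph1 (augPi tensor_rel_eps)).
Qed.

Lemma tensLP k a a' : tensL (k *: a + a') = k *: tensL a + tensL a'.
Proof.
apply: etrans (tens_rel_eq (TensLlin k a a')) _.
exact: (linearP (augPi tensor_rel_eps)).
Qed.

Lemma tensLR a b : tensL a * tensR b = tensR b * tensL a.
Proof.
apply: etrans (esym (rmorphM (augPi tensor_rel_eps) _ _)) _.
apply: etrans (tens_rel_eq (TensComm a b)) _.
exact: (rmorphM (augPi tensor_rel_eps)).
Qed.

Lemma tensM a b a' b' : tens a b * tens a' b' = tens (a * a') (b * b').
Proof.
rewrite !tensE tensLM tensRM !mulrA; congr (_ * _).
by rewrite -!mulrA; congr (_ * _); rewrite tensLR.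
Qed.

Lemma tens1 : tens 1 1 = 1.
Proof. by rewrite tensE tensL1 tensR1 mulr1. Qed.

Lemma tensZl k a b : tens (k *: a) b = k *: tens a b.
Proof.
have L0 : tensL 0 = 0.
  have := tensLP 1 0 0; rewrite !scale1r addr0 => /eqP.
  by rewrite -[X in X == _]addr0 (inj_eq (addrI _)) eq_sym => /eqP.
by rewrite !tensE -[k *: a]addr0 tensLP L0 addr0 scalerAl.
Qed.

(* The image of L (x) R in A (x) B for subspaces L of A and R of B. *)
Definition sub_tensor (L : A -> Prop) (R : B -> Prop) (c : tensor) : Prop :=
  exists s : seq (A * B), (forall p, p \in s -> L p.1 /\ R p.2)
    /\ c = \sum_(p <- s) tens p.1 p.2.

End Tensor.

(* The indices 1, 2, 3, 4 are the elements of value 0, 1, 2, 3 of 'I_4. *)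

Definition i1 : 'I_4 := @Ordinal 4 0 isT.
Definition i2 : 'I_4 := @Ordinal 4 1 isT.
Definition i3 : 'I_4 := @Ordinal 4 2 isT.
Definition i4 : 'I_4 := @Ordinal 4 3 isT.

(* word k is u_k for 1 <= k <= 24 (position 0 is a dummy). *)
Definition words : seq (seq 'I_4) :=
  [:: [::];
      [:: i1];
      [:: i1; i2];
      [:: i1; i2; i3];
      [:: i1; i2; i3; i3];
      [:: i1; i2; i3; i3; i2];
      [:: i1; i2; i3; i4];
      [:: i1; i2; i3; i4; i3];
      [:: i1; i2; i3; i4; i3; i1; i2; i3; i4; i3; i2];
      [:: i1; i2; i3; i4; i3; i2];
      [:: i1; i2; i3; i4; i3; i2; i3];
      [:: i1; i2; i3; i4; i3; i4];
      [:: i1; i2; i3; i4; i3; i4; i2];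
      [:: i1; i2; i3; i4; i3; i4; i2; i3];
      [:: i1; i2; i3; i4; i3; i4; i2; i3; i3];
      [:: i1; i2; i3; i4; i3; i4; i2; i3; i3; i2];
      [:: i2];
      [:: i2; i3];
      [:: i2; i3; i3];
      [:: i2; i3; i4];
      [:: i2; i3; i4; i3];
      [:: i2; i3; i4; i3; i4];
      [:: i3];
      [:: i3; i4];
      [:: i4]].
Definition word (k : nat) : seq 'I_4 := nth [::] words k.

(* Coordinates on the basis of simple roots. *)
Definition rootLattice := {ffun 'I_4 -> int}.
Definition simpleRoot (c : 'I_4) : rootLattice := [ffun i => (i == c)%:Z].
Definition beta (k : nat) : rootLattice := \sum_(c <- word k) simpleRoot c.

(* (k, i, j) stands for k = (i, j). Both members of a pair occur among the
   simple ones 1, 16, 22, 24 or earlier in the list. *)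
Definition root_pairs : seq (nat * nat * nat) :=
  [:: (2, 1, 16); (3, 2, 22); (4, 3, 22); (5, 4, 16); (6, 3, 24);
      (7, 6, 22); (9, 7, 16); (8, 7, 9); (10, 9, 22); (11, 7, 24);
      (12, 11, 16); (13, 12, 22); (14, 13, 22); (15, 14, 16);
      (17, 16, 22); (18, 17, 22); (19, 17, 24); (20, 19, 22);
      (21, 20, 24); (23, 22, 24)]%N.

Lemma root_pairs_beta k i j :
  (k, i, j) \in root_pairs -> beta k = beta i + beta j.
Proof.
move=> h; suff : all (fun t : nat * nat * nat =>
    perm_eq (word t.1.1) (word t.1.2 ++ word t.2)) root_pairs.
  by move/allP/(_ _ h) => /= pw; rewrite /beta (perm_big _ pw) big_cat.
by vm_compute.
Qed.

(* The family indexed by 1 .. 24 obtained from the values g on the simple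
   roots by v_k = br i j v_i v_j for k = (i, j). *)
Definition root_family (T : Type) (dflt : T) (g : 'I_4 -> T)
    (br : nat -> nat -> T -> T -> T) : nat -> T :=
  foldl (fun v t => let: (k, i, j) := t in
           fun n => if n == k then br i j (v i) (v j) else v n)
        (fun n => if n == 1%N then g i1 else if n == 16%N then g i2 else
                  if n == 22%N then g i3 else if n == 24%N then g i4 else dflt)
        root_pairs.

Inductive gen : Type :=
| GE of 'I_4 | GF of 'I_4
| Gw of 'I_4 | GwV of 'I_4     (* omega_i, omega_i^-1 *)
| Gw' of 'I_4 | Gw'V of 'I_4.  (* omega'_i, omega'_i^-1 *)

Definition gen_code (x : gen) : nat * 'I_4 :=
  match x with
  | GE i => (0, i) | GF i => (1, i) | Gw i => (2, i) | GwV i => (3, i)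
  | Gw' i => (4, i) | Gw'V i => (5, i)
  end%N.
Definition gen_decode (c : nat * 'I_4) : gen :=
  match c.1 with
  | 0 => GE c.2 | 1 => GF c.2 | 2 => Gw c.2 | 3 => GwV c.2
  | 4 => Gw' c.2 | _ => Gw'V c.2
  end%N.
Lemma gen_codeK : cancel gen_code gen_decode. Proof. by case. Qed.
HB.instance Definition _ := Choice.copy gen (can_type gen_codeK).

Definition is_torus (x : gen) : bool :=
  match x with GE _ | GF _ => false | _ => true end.

Section QuantumGroup.
Variables (K : fieldType) (r s : K).

Definition rr (i : 'I_4) : K := if (i < 2)%N then r ^+ 2 else r.
Definition ss (i : 'I_4) : K := if (i < 2)%N then s ^+ 2 else s.

Definition aa (i j : 'I_4) : K :=
  nth 0 (nth [::]
    [:: [:: r ^+ 2 * s ^- 2; s ^+ 2;          1;        1       ];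
        [:: r ^- 2;          r ^+ 2 * s ^- 2; s ^+ 2;   1       ];
        [:: 1;               r ^- 2;          r * s^-1; s       ];
        [:: 1;               1;               r^-1;     r * s^-1]] i) j.

(* Each relation sum c w = 0 is given by its list of pairs (c, w). *)
Definition serre : seq (seq (K * seq 'I_4)) :=
  let q := r ^- 2 + r^-1 * s^-1 + s ^- 2 in
  [:: [:: (1, [:: i1; i1; i2]); (- (r ^+ 2 + s ^+ 2), [:: i1; i2; i1]);
          (r ^+ 2 * s ^+ 2, [:: i2; i1; i1])];
      [:: (1, [:: i2; i2; i1]); (- (r ^- 2 + s ^- 2), [:: i2; i1; i2]);
          (r ^- 2 * s ^- 2, [:: i1; i2; i2])];
      [:: (1, [:: i2; i2; i3]); (- (r ^+ 2 + s ^+ 2), [:: i2; i3; i2]);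
          (r ^+ 2 * s ^+ 2, [:: i3; i2; i2])];
      [:: (1, [:: i3; i3; i3; i2]); (- q, [:: i3; i3; i2; i3]);
          (r^-1 * s^-1 * q, [:: i3; i2; i3; i3]);
          (- (r ^- 3 * s ^- 3), [:: i2; i3; i3; i3])];
      [:: (1, [:: i3; i3; i4]); (- (r + s), [:: i3; i4; i3]);
          (r * s, [:: i4; i3; i3])];
      [:: (1, [:: i4; i4; i3]); (- (r^-1 + s^-1), [:: i4; i3; i4]);
          (r^-1 * s^-1, [:: i3; i4; i4])]].

Let Free := freeAlg K gen.
Let v (x : gen) : Free := freeVar x.

Inductive U_rel : Free -> Prop :=
| RelTorus x y : is_torus x -> is_torus y -> U_rel (v x * v y - v y * v x)
| RelW i : U_rel (v (Gw i) * v (GwV i) - 1)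
| RelW' i : U_rel (v (Gw' i) * v (Gw'V i) - 1)
| RelWE i j : U_rel (v (Gw i) * v (GE j) * v (GwV i) - aa i j *: v (GE j))
| RelWF i j : U_rel (v (Gw i) * v (GF j) * v (GwV i) - (aa i j)^-1 *: v (GF j))
| RelW'E i j :
    U_rel (v (Gw' i) * v (GE j) * v (Gw'V i) - (aa j i)^-1 *: v (GE j))
| RelW'F i j : U_rel (v (Gw' i) * v (GF j) * v (Gw'V i) - aa j i *: v (GF j))
| RelEF i j :
    U_rel (v (GE i) * v (GF j) - v (GF j) * v (GE i)
           - (i == j)%:R *: ((rr i - ss i)^-1 *: (v (Gw i) - v (Gw' i))))
| RelEE (i j : 'I_4) : (i.+1 < j)%N || (j.+1 < i)%N ->
    U_rel (v (GE i) * v (GE j) - v (GE j) * v (GE i))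
| RelFF (i j : 'I_4) : (i.+1 < j)%N || (j.+1 < i)%N ->
    U_rel (v (GF i) * v (GF j) - v (GF j) * v (GF i))
| RelSerreE p : p \in serre ->
    U_rel (\sum_(t <- p) t.1 *: \prod_(c <- t.2) v (GE c))
| RelSerreF p : p \in serre ->
    U_rel (\sum_(t <- p) t.1 *: \prod_(c <- rev t.2) v (GF c)).

Definition free_eps : Free -> K^o :=
  freeEval (fun x : gen => (is_torus x)%:R : K^o).
HB.instance Definition _ := GRing.LRMorphism.on free_eps.

Fact U_rel_eps g : U_rel g -> free_eps g = 0.
Proof.
have Ev x : free_eps (v x) = (is_torus x)%:R by apply: freeEval_var.
have EM x y : free_eps (x * y) = free_eps x * free_eps y by apply: rmorphM.
have EB x y : free_eps (x - y) = free_eps x - free_eps y by apply: raddfB.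
have EZ k x : free_eps (k *: x) = k *: free_eps x by apply: linearZ.
have E1 : free_eps 1 = 1 by apply: rmorph1.
have Ecomm x y : free_eps (v x * v y - v y * v x) = 0.
  rewrite EB; apply/eqP; rewrite subr_eq0; apply/eqP.
  exact: etrans (EM _ _) (etrans (mulrC _ _) (esym (EM _ _))).
have Ew (f : 'I_4 -> gen) (w : seq 'I_4) : (forall c, ~~ is_torus (f c)) ->
    w != [::] -> free_eps (\prod_(c <- w) v (f c)) = 0.
  move=> hf; case: w => // c w _.
  by rewrite big_cons EM Ev (negbTE (hf c)) mul0r.
have Hs : all (fun p : seq (K * seq 'I_4) => all (fun t => t.2 != [::]) p) serre
  by [].
case=> [x y hx hy|i|i|i j|i j|i j|i j|i j|i j _|i j _|p hp|p hp].
- by rewrite Ecomm.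
- by rewrite EB EM !Ev E1 mulr1 subrr.
- by rewrite EB EM !Ev E1 mulr1 subrr.
- by rewrite EB !EM EZ !Ev mulr0 mul0r scaler0 subrr.
- by rewrite EB !EM EZ !Ev mulr0 mul0r scaler0 subrr.
- by rewrite EB !EM EZ !Ev mulr0 mul0r scaler0 subrr.
- by rewrite EB !EM EZ !Ev mulr0 mul0r scaler0 subrr.
- by rewrite EB Ecomm EZ EZ EB !Ev subrr !scaler0 subr0.
- by rewrite Ecomm.
- by rewrite Ecomm.
- apply: etrans (raddf_sum free_eps _ _ _) _; rewrite big_seq big1 // => t ht.
  apply: etrans (EZ _ _) _; rewrite Ew ?scaler0 //.
  by move/allP: Hs => /(_ _ hp) /allP /(_ _ ht).
- apply: etrans (raddf_sum free_eps _ _ _) _; rewrite big_seq big1 // => t ht.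
  apply: etrans (EZ _ _) _; rewrite Ew ?scaler0 //.
  rewrite -size_eq0 size_rev size_eq0.
  by move/allP: Hs => /(_ _ hp) /allP /(_ _ ht).
Qed.

Definition Urs : algType K := augQuot U_rel_eps.
Definition Ugen (x : gen) : Urs := augPi U_rel_eps (v x).
Definition Ueps : {lrmorphism Urs -> K^o} := @augEps _ _ _ _ U_rel_eps.

(* rs_pairing eta zeta is <omega'_eta, omega_zeta>. *)
Definition rs_pairing (eta zeta : rootLattice) : K :=
  \prod_(i < 4) \prod_(j < 4) (aa i j) ^ (zeta i * eta j).

Definition rootE : nat -> Urs :=
  root_family 0 (fun c => Ugen (GE c)) (fun i j x y =>
    x * y - rs_pairing (beta j) (beta i) *: (y * x)).

Definition rootF : nat -> Urs :=
  root_family 0 (fun c => Ugen (GF c)) (fun i j x y =>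
    y * x - (rs_pairing (beta i) (beta j))^-1 *: (x * y)).

Variables (l : nat) (l_odd : odd l).

Inductive u_rel : Urs -> Prop :=
| RelEpow k : (1 <= k <= 24)%N -> u_rel (rootE k ^+ l)
| RelFpow k : (1 <= k <= 24)%N -> u_rel (rootF k ^+ l)
| RelWpow i : u_rel (Ugen (Gw i) ^+ l - 1)
| RelW'pow i : u_rel (Ugen (Gw' i) ^+ l - 1).

Fact u_rel_eps g : u_rel g -> Ueps g = 0.
Proof.
have Ev x : Ueps (Ugen x) = (is_torus x)%:R.
  by apply: etrans (augEpsE _ _) _; apply: freeEval_var.
have EM x y : Ueps (x * y) = Ueps x * Ueps y by apply: rmorphM.
have EX x n : Ueps (x ^+ n) = Ueps x ^+ n by apply: rmorphXn.
have EB x y : Ueps (x - y) = Ueps x - Ueps y by apply: raddfB.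
have EZ k x : Ueps (k *: x) = k *: Ueps x by apply: linearZ.
have E0 : Ueps 0 = 0 by apply: raddf0.
have E1 : Ueps 1 = 1 by apply: rmorph1.
have l0 : (0 < l)%N by apply: odd_gt0.
have fam (g' : 'I_4 -> Urs) br : (forall c, Ueps (g' c) = 0) ->
    (forall i j x y, Ueps x = 0 -> Ueps y = 0 -> Ueps (br i j x y) = 0) ->
    forall k, Ueps (root_family 0 g' br k) = 0.
  move=> hg hbr; rewrite /root_family; set v0 := fun n : nat => _.
  have : forall k, Ueps (v0 k) = 0.
    by move=> k; rewrite /v0; do 4![case: ifP => _ //].
  elim: root_pairs v0 => // [[[k i] j]] t IH v0 h0 /=.
  by apply: IH => n; case: ifP => _ //; apply: hbr.
case=> [k _|k _|i|i].
- have rootE0 : Ueps (rootE k) = 0.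
    apply: fam => [c|i j x y hx hy]; first by rewrite Ev.
    by rewrite EB EZ !EM hx hy mul0r scaler0 subrr.
  by rewrite EX rootE0 expr0n gtn_eqF.
- have rootF0 : Ueps (rootF k) = 0.
    apply: fam => [c|i j x y hx hy]; first by rewrite Ev.
    by rewrite EB EZ !EM hx hy mul0r scaler0 subrr.
  by rewrite EX rootF0 expr0n gtn_eqF.
- by rewrite EB EX Ev E1 expr1n subrr.
- by rewrite EB EX Ev E1 expr1n subrr.
Qed.

Definition urs : algType K := augQuot u_rel_eps.
Definition upi : Urs -> urs := augPi u_rel_eps.
Definition ugen (x : gen) : urs := upi (Ugen x).
Definition ueps : {lrmorphism urs -> K^o} := @augEps _ _ _ _ u_rel_eps.

Definition urootE (k : nat) : urs := upi (rootE k).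

Definition free_to_u (p : Free) : urs := upi (augPi U_rel_eps p).

Definition tensor_uu : algType K := tensor ueps ueps.
Definition uten : urs -> urs -> tensor_uu := @tens K urs urs ueps ueps.

Definition comul_gen (x : gen) : tensor_uu :=
  match x with
  | GE i => uten (ugen (GE i)) 1 + uten (ugen (Gw i)) (ugen (GE i))
  | GF i => uten 1 (ugen (GF i)) + uten (ugen (GF i)) (ugen (Gw' i))
  | x => uten (ugen x) (ugen x)
  end.

Definition antipode_gen (x : gen) : urs :=
  match x with
  | GE i => - (ugen (GwV i) * ugen (GE i))
  | GF i => - (ugen (GF i) * ugen (Gw'V i))
  | Gw i => ugen (GwV i) | GwV i => ugen (Gw i)
  | Gw' i => ugen (Gw'V i) | Gw'V i => ugen (Gw' i)
  end.

(* Graphs of Delta and S on u_{r,s}(F_4): both are induced by their values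
   on the generators, through a preimage in the free algebra (the defining
   ideal being a Hopf ideal, the preimage p does not matter). *)
Definition comul_graph (a : urs) (c : tensor_uu) : Prop :=
  exists p : Free, free_to_u p = a /\ freeEval comul_gen p = c.

Definition antipode_graph (a b : urs) : Prop :=
  exists p : Free, free_to_u p = a /\ freeAntiEval antipode_gen p = b.

Definition subalgebra (B : urs -> Prop) : Prop :=
  [/\ B 1, forall (k : K) x y, B x -> B y -> B (k *: x + y)
         & forall x y, B x -> B y -> B (x * y)].

Definition hopf_subalgebra (B : urs -> Prop) : Prop :=
  [/\ subalgebra B,
      forall a, B a -> exists2 c, comul_graph a c & sub_tensor B B c
    & forall a, B a -> exists2 b, antipode_graph a b & B b].

Definition contains_b_gens (B : urs -> Prop) : Prop :=
  forall i, [/\ B (ugen (GE i)), B (ugen (Gw i)) & B (ugen (GwV i))].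

Definition frakb (a : urs) : Prop :=
  forall B, hopf_subalgebra B -> contains_b_gens B -> B a.

(* The subalgebra generated by the E_i and omega_i^{+-1} is already stable
   under Delta and S. *)
Lemma frakb_subalgebra (a : urs) :
  frakb a <-> (forall B, subalgebra B -> contains_b_gens B -> B a).
Proof.
split=> [|h]; last by move=> B [hB _ _]; apply: h.
pose B0 x := forall B, subalgebra B -> contains_b_gens B -> B x.
have B0s : subalgebra B0.
  split=> [B []//|k x y hx hy B hB gB|x y hx hy B hB gB].
    by case: (hB) => _ h _; apply: h; [apply: hx|apply: hy].
  by case: (hB) => _ _ h; apply: h; [apply: hx|apply: hy].
have B0g : contains_b_gens B0 by move=> i; split=> B _ /(_ i) [].
have [B01 B0l B0m] := B0s.
have B00 : B0 0 by rewrite -[0](addNr (1 : urs)) -scaleN1r; apply: B0l.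
have pL k p q : free_to_u (k *: p + q) = k *: free_to_u p + free_to_u q.
  rewrite /free_to_u /upi.
  by rewrite -[augPi U_rel_eps _]/((augPi U_rel_eps : {lrmorphism _ -> _}) _) !linearP.
have pM p q : free_to_u (p * q) = free_to_u p * free_to_u q.
  by rewrite /free_to_u /upi !rmorphM.
have p1 : free_to_u 1 = 1 by rewrite /free_to_u /upi !rmorph1.
move=> /(_ B0) h; apply: h (B0g); split=> // {}a ha.
- pose P x := B0 x /\ exists2 c, comul_graph x c & sub_tensor B0 B0 c.
  have [//] : P a; apply: (ha P) => [|i].
      split=> [|k x y [hx [? [p [? ?]] [sx [hsx ex]]]]
                     [hy [? [q [? ?]] [sy [hsy ey]]]]
              |x y [hx [? [p [? ?]] [sx [hsx ex]]]]
                     [hy [? [q [? ?]] [sy [hsy ey]]]]].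
      + split=> //; exists 1; first by exists 1; rewrite p1 rmorph1.
        exists [:: (1, 1)]; split=> [p|]; first by rewrite inE => /eqP ->.
        by rewrite big_seq1 tens1.
      + subst; split; first exact: B0l.
        exists (freeEval comul_gen (k *: p + q)); first by exists (k *: p + q); rewrite pL.
        exists ([seq (k *: t.1, t.2) | t <- sx] ++ sy); split=> [t|].
          rewrite mem_cat => /orP[/mapP[t' /hsx[h1 h2] ->]|/hsy //].
          split=> //=; rewrite -[k *: _]addr0; exact: B0l.
        rewrite linearP /= ex ey big_cat big_map /= scaler_sumr.
        by congr (_ + _); apply: eq_bigr => t _; rewrite tensZl.
      + subst; split; first exact: B0m.
        exists (freeEval comul_gen (p * q)); first by exists (p * q); rewrite pM.
        exists [seq (t.1 * t'.1, t.2 * t'.2) | t <- sx, t' <- sy]; split=> [t|].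
          by move=> /allpairsP[[t1 t2] /= [/hsx[? ?] /hsy[? ?] ->]]; split; apply: B0m.
        rewrite rmorphM /= ex ey big_allpairs_dep /= mulr_suml.
        apply: eq_bigr => t _; rewrite mulr_sumr.
        by apply: eq_bigr => t' _; rewrite tensM.
    have [hE hW hV] := B0g i.
    have key x : free_to_u (v x) = ugen x by [].
    split; split=> //.
    + exists (comul_gen (GE i)); first by exists (v (GE i)); rewrite key freeEval_var.
      exists [:: (ugen (GE i), 1); (ugen (Gw i), ugen (GE i))]; split=> [t|].
        by rewrite !inE => /orP[] /eqP ->.
      by rewrite big_cons big_seq1.
    + exists (comul_gen (Gw i)); first by exists (v (Gw i)); rewrite key freeEval_var.
      exists [:: (ugen (Gw i), ugen (Gw i))]; split=> [t|].
        by rewrite !inE => /eqP ->.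
      by rewrite big_seq1.
    + exists (comul_gen (GwV i)); first by exists (v (GwV i)); rewrite key freeEval_var.
      exists [:: (ugen (GwV i), ugen (GwV i))]; split=> [t|].
        by rewrite !inE => /eqP ->.
      by rewrite big_seq1.
- pose P x := B0 x /\ exists2 b, antipode_graph x b & B0 b.
  have [//] : P a; apply: (ha P) => [|i].
      split=> [|k x y [hx [? [p [? ?]] sx]] [hy [? [q [? ?]] sy]]
              |x y [hx [? [p [? ?]] sx]] [hy [? [q [? ?]] sy]]].
      + by split=> //; exists 1 => //; exists 1; rewrite p1 freeAntiEval1.
      + subst; split; first exact: B0l.
        exists (freeAntiEval antipode_gen (k *: p + q)); first by exists (k *: p + q); rewrite pL.
        by rewrite linearP; apply: B0l.
      + subst; split; first exact: B0m.
        exists (freeAntiEval antipode_gen (p * q)); first by exists (p * q); rewrite pM.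
        by rewrite freeAntiEvalM; apply: B0m.
    have [hE hW hV] := B0g i.
    have key x : free_to_u (v x) = ugen x by [].
    split; split=> //.
    + exists (antipode_gen (GE i)); first by exists (v (GE i)); rewrite key freeAntiEval_var.
      rewrite /= -[X in B0 X]addr0 -scaleN1r; apply: B0l => //.
      exact: B0m.
    + by exists (antipode_gen (Gw i)) => //; exists (v (Gw i)); rewrite key freeAntiEval_var.
    + by exists (antipode_gen (GwV i)) => //; exists (v (GwV i)); rewrite key freeAntiEval_var.
Qed.

Definition left_integral (y : urs) : Prop :=
  frakb y /\ forall a, frakb a -> a * y = (ueps a : K) *: y.

Definition right_integral (y : urs) : Prop :=
  frakb y /\ forall a, frakb a -> y * a = (ueps a : K) *: y.

End QuantumGroup.

(* Main.v *)
(* Write X_k for E_{beta_k}. The point is that every product X_i X_j with i < j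
   is a multiple of X_j X_i plus a combination of words of the same height in
   letters X_k with k > i. Hence the subalgebra of the X_k with k > i is the sum
   of the A X_{i+1}^a, where A is the subalgebra of the X_k with k > i + 1; as
   X_k^l = 0, a downward induction on i bounds its heights by the sum of the
   (l - 1) ht(beta_k) over k > i. For i = 0 the bound is the height of x, so
   E_i x = 0 = x E_i. Since E_i t = t' E_i and t E_i = E_i t'' for some t', t'',
   and omega_i t = t = t omega_i, the generators of b act on t x and on x t
   through the counit.

   The 276 straightening rules are found by noncommutative Groebner completion:
   starting from the definitions of the root vectors, the commutations and the
   Serre relations, each new rule comes from the two ways of rewriting some
   X_i X_j X_k with i < j < k. The computation takes place over
   Z[r^{+-1}, s^{+-1}]; the divisions it needs are by r + s, r^2 + rs + s^2,
   r^2 + s^2 and r - s, which do not vanish because r^2 <> s^2, r^3 <> s^3 and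
   l is odd. *)

Require Import Defs.
From HB Require Import structures.
From mathcomp Require Import all_boot all_order all_algebra all_field ring.

Set Implicit Arguments.
Unset Strict Implicit.
Unset Printing Implicit Defensive.

Import Order.TTheory GRing.Theory Num.Theory.
Local Open Scope ring_scope.

(** * Noncommutative polynomials with Laurent coefficients, as computable lists *)

(* (c, (a, b, w)) stands for c r^a s^b times the word w in the letters X_k. *)
Definition ncterm := (int * (int * int * seq nat))%type.
Definition ncpoly := seq ncterm.
(* (c, a, b) stands for c r^a s^b. *)
Definition laurent := seq (int * int * int).

Fixpoint word_cmp (u v : seq nat) : comparison :=
  match u, v with
  | [::], [::] => Eq
  | [::], _ => Lt
  | _, [::] => Gt
  | i :: u', j :: v' =>
      if Nat.compare i j is Eq then word_cmp u' v' else Nat.compare i j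
  end.

Definition int_cmp (a b : int) : comparison :=
  match a, b with
  | Posz m, Posz n => Nat.compare m n
  | Negz m, Negz n => Nat.compare n m
  | Posz _, Negz _ => Gt
  | Negz _, Posz _ => Lt
  end.

(* Larger powers of r come first, as the division [ncdiv] expects. *)
Definition mono_cmp (m n : int * int * seq nat) : comparison :=
  if word_cmp m.2 n.2 is Eq then
    if int_cmp n.1.1 m.1.1 is Eq then int_cmp n.1.2 m.1.2
    else int_cmp n.1.1 m.1.1
  else word_cmp m.2 n.2.

(** A merge that adds equal monomials and drops zero sums; the inner fixpoint makes the recursion
    structural whichever list advances. *)
Fixpoint ncadd (p q : ncpoly) : ncpoly :=
  if p is t :: p' then
    (fix ncadd_t q := if q is t' :: q' then
       match mono_cmp t.2 t'.2 with
       | Lt => t :: ncadd p' q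
       | Gt => t' :: ncadd_t q'
       | Eq => if t.1 + t'.1 == 0 then ncadd p' q'
               else (t.1 + t'.1, t.2) :: ncadd p' q'
       end else p) q
  else q.

Fixpoint ncpair (ps : seq ncpoly) : seq ncpoly :=
  if ps is p :: q :: ps' then ncadd p q :: ncpair ps' else ps.

(** Bottom-up merge sort: twelve rounds of pairwise merging exhaust up to 2^12 terms, and the final
    fold merges whatever lists remain. *)
Definition ncsort (p : ncpoly) : ncpoly :=
  foldr ncadd [::] (iter 12 ncpair [seq [:: t] | t <- p]).

Definition ncmul (c a b : int) (u v : seq nat) (p : ncpoly) : ncpoly :=
  [seq (c * t.1, (a + t.2.1.1, b + t.2.1.2, u ++ t.2.2 ++ v)) | t <- p].

Definition ncscale (f : laurent) (p : ncpoly) : ncpoly :=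
  ncsort (flatten [seq ncmul t.1.1 t.1.2 t.2 [::] [::] p | t <- f]).

(** * Rewriting by rules, and completion of a system of rules *)

(* The rule at (i, j) gives the right-hand side of X_i X_j = ...; an empty one
   means that no rule is known. *)
Definition rules := seq (seq ncpoly).
Definition rule (R : rules) i j : ncpoly := nth [::] (nth [::] R i) j.
Definition add_rule (R : rules) i j p : rules :=
  set_nth [::] R i (set_nth [::] (nth [::] R i) j p).

Fixpoint reduce_word (R : rules) c a b (u w : seq nat) : option ncpoly :=
  if w is i :: w' then
    if w' is j :: v then
      if rule R i j is [::] then reduce_word R c a b (rcons u i) w'
      else Some (ncmul c a b u v (rule R i j))
    else None
  else None.

Definition reduce_term (R : rules) (t : ncterm) : option ncpoly :=
  reduce_word R t.1 t.2.1.1 t.2.1.2 [::] t.2.2.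

(** Irreducible terms are set aside in each round, so only the rewritten ones are processed again;
    [n] is fuel. *)
Fixpoint reduce n (R : rules) (p : ncpoly) : ncpoly :=
  if n is n'.+1 then
    let q := pmap (reduce_term R) p in
    if q is [::] then p else
    ncadd [seq t <- p | ~~ reduce_term R t] (reduce n' R (ncsort (flatten q)))
  else p.

(* Exact division of a sorted p by f, whose head must be the monic top power of
   r; the result is checked by multiplication in [derive], n being fuel. *)
Fixpoint ncdiv n (f : laurent) (p : ncpoly) : ncpoly :=
  match n, p, f with
  | n'.+1, (c, (a, b, w)) :: _, (_, k, _) :: _ =>
    (c, (a - k, b, w)) :: ncdiv n' f (ncadd p (ncscale f [:: (- c, (a - k, b, w))]))
  | _, _, _ => [::]
  end.

(* Overlap i j k is X_i X_j X_k rewritten on the left minus the same on the right. *)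
Inductive relation := Serre of nat | Overlap of nat & nat & nat.

(* A combination of relations that reduces to a multiple, by the product of the
   denominators and a unit, of a relation with a single new product X_i X_j. *)
Record derivation := Derivation {
  combination : seq (laurent * relation);
  denominators : seq nat }.

Definition one : laurent := [:: (1, 0, 0)].
Definition r_plus_s : laurent := [:: (1, 1, 0); (1, 0, 1)].
Definition factors : seq laurent :=
  [:: r_plus_s; [:: (1, 2, 0); (1, 1, 1); (1, 0, 2)];
      [:: (1, 2, 0); (1, 0, 2)]; [:: (1, 1, 0); (-1, 0, 1)]].

(** A product without a rule stands for itself, so that an overlap is a valid relation whichever
    rules are known. *)
Definition monic_rule (R : rules) i j : ncpoly :=
  if rule R i j is [::] then [:: (1, (0, 0, [:: i; j]))] else rule R i j.

Definition relation_poly (zs : seq ncpoly) (R : rules) (x : relation) : ncpoly :=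
  match x with
  | Serre n => nth [::] zs n
  | Overlap i j k => ncmul 1 0 0 [::] [:: k] (monic_rule R i j)
                       ++ ncmul (-1) 0 0 [:: i] [::] (monic_rule R j k)
  end.

(** In a reduced polynomial such a word is a product that has no rule yet. *)
Definition disordered (t : ncterm) : bool :=
  if t.2.2 is [:: i; j] then (i < j)%N else false.

(** Any failed test leaves [R] unchanged, so soundness asks nothing of the plan or of the fuel 60
    and 1000. The test [c * c == 1] makes the coefficient of the new product a unit, so that solving
    for it needs no division. *)
Definition derive (zs : seq ncpoly) (R : rules) (d : derivation) : rules :=
  let z := reduce 60 R (ncsort (flatten
    [seq ncscale x.1 (relation_poly zs R x.2) | x <- combination d])) in
  let fs := [seq nth one factors k | k <- denominators d] in
  let q := foldl (fun p f => ncdiv 1000 f p) z fs in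
  if foldl (fun p f => ncscale f p) q fs == z then
    if [seq t <- q | disordered t] is [:: (c, (a, b, [:: i; j]))] then
      if c * c == 1 then
        add_rule R i j
          (ncmul (- c) (- a) (- b) [::] [::] [seq t <- q | ~~ disordered t])
      else R
    else R
  else R.

Definition from (i j k : nat) : derivation :=
  Derivation [:: (one, Overlap i j k)] [::].

(* By increasing height of beta_i + beta_j. Several overlaps are combined when
   each of them involves two or three new products. *)
Definition plan : seq derivation :=
  [::
   Derivation [:: (one, Serre 0)] [::]; Derivation [:: (one, Serre 1)] [::];
   Derivation [:: (one, Serre 2)] [::]; Derivation [:: (one, Serre 3)] [::];
   Derivation [:: (one, Serre 4)] [::]; Derivation [:: (one, Serre 5)] [::];
   from 16 22 24; from 1 22 24; from 1 16 24; from 1 16 22; from 16 23 24;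
   from 16 22 23; from 17 22 24; from 16 17 24; from 16 17 22; from 1 17 24;
   from 1 16 23; from 1 17 22;
   Derivation [:: ([:: (1, -2, 2)], Overlap 1 16 17);
     ([:: (-1, 0, 0)], Overlap 2 16 22)] [:: 2%N];
   from 1 16 17; from 1 2 22; from 17 23 24;
   Derivation [:: ([:: (-1, 0, 0)], Overlap 17 22 23);
     ([:: (-1, 0, 0)], Overlap 18 22 24)] [:: 1%N];
   from 17 22 23;
   Derivation [:: ([:: (1, 0, 0)], Overlap 16 17 23);
     ([:: (-1, 1, 0)], Overlap 16 19 22)] [:: 2%N];
   from 16 17 23; from 16 18 22; from 1 19 24; from 1 19 22; from 1 17 23;
   from 1 18 24; from 1 18 22; from 2 17 24; from 1 16 19; from 3 16 22;
   from 1 16 18; from 1 2 23; from 1 3 22; from 1 2 17; from 19 23 24;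
   Derivation [:: (one, Overlap 18 23 24)] [:: 0%N]; from 19 22 23;
   from 16 19 23; from 16 20 22; from 17 18 24; from 1 20 24; from 1 19 23;
   from 1 18 23; from 1 20 22; from 3 16 23; from 1 17 19; from 1 16 20;
   from 2 18 24;
   Derivation [:: ([:: (1, -2, 2)], Overlap 1 17 18);
     ([:: (-1, -2, 0)], Overlap 2 18 22);
     ([:: (-1, -1, 1)], Overlap 3 17 22)] [:: 1%N];
   from 1 17 18; from 2 18 22; from 2 16 18; from 1 3 23; from 1 2 19;
   from 2 3 22; from 1 2 18; from 20 23 24;
   Derivation [:: (one, Overlap 18 19 24)] [:: 0%N]; from 16 21 22;
   from 17 18 23; from 1 21 24; from 1 20 23; from 1 21 22; from 6 16 23;
   from 1 16 21; from 2 20 24; from 2 20 22; from 3 18 24; from 1 17 20;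
   from 1 18 19; from 2 18 23; from 3 18 22; from 2 16 20; from 2 17 18;
   from 1 6 23;
   Derivation [:: ([:: (1, 0, 0)], Overlap 2 3 23);
     ([:: (-1, 1, 0)], Overlap 2 6 22)] [:: 2%N];
   from 2 3 23; from 1 2 20; from 1 3 18; from 1 5 16; from 16 21 23;
   from 17 21 22; from 1 21 23; from 2 21 24; from 2 21 22; from 11 16 22;
   Derivation [:: (one, Overlap 1 17 21)] [:: 0%N; 3%N]; from 1 19 20;
   from 2 20 23; from 3 20 24; from 4 17 23; from 1 18 20; from 3 20 22;
   from 2 16 21; from 2 17 20; from 2 18 19; from 3 16 20; from 3 17 18;
   from 1 9 24; from 1 11 16; from 1 9 22; from 1 7 17; from 1 4 19;
   from 1 9 16; from 2 3 18; from 17 21 23;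
   Derivation [:: ([:: (1, 2, -2)], Overlap 3 21 24);
     ([:: (-1, 4, -2)], Overlap 6 20 24)] [:: 1%N];
   from 3 21 24; from 1 19 21; from 2 21 23; from 3 21 22; from 6 20 22;
   from 1 18 21; from 3 20 23; from 2 19 20; from 2 17 21; from 6 16 20;
   from 3 18 19; from 2 18 20; from 3 17 20;
   Derivation [:: (one, Overlap 4 6 24)] [:: 0%N]; from 1 9 23; from 1 11 17;
   from 1 4 20; from 1 12 16; from 1 10 16; from 1 9 17; from 2 5 23;
   from 2 4 18; from 6 21 22; from 1 20 21; from 6 20 23; from 7 20 24;
   from 7 20 22; from 2 19 21; from 10 16 23; from 3 19 20; from 4 16 21;
   from 2 18 21; from 6 17 20; from 3 18 20; from 1 6 21; from 1 10 23;
   from 1 11 18; from 1 13 16; from 2 3 21; from 2 6 20; from 1 10 17;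
   from 1 9 18; from 2 7 18; from 6 21 23; from 7 20 23; from 11 16 20;
   from 2 20 21; from 6 19 20; from 9 20 24; from 7 18 19;
   Derivation [:: (one, Overlap 4 17 21)] [:: 0%N]; from 7 17 20; from 9 20 22;
   from 9 16 20; from 1 7 21; from 2 6 21; from 4 9 24; from 4 11 16;
   from 6 7 17; from 2 7 20; from 1 14 16; from 1 13 17; from 1 10 18;
   from 2 5 20; from 6 19 21; from 9 21 22; from 10 20 24; from 7 19 20;
   from 9 20 23; from 7 18 20; from 9 17 20;
   Derivation [:: ([:: (-1, 3, -3)], Overlap 2 11 20);
     ([:: (1, 3, -3); (-1, 2, -2)], Overlap 2 13 23)] [::];
   from 2 13 23; from 1 12 20; from 6 10 24; from 4 6 20;
   Derivation [:: (one, Overlap 3 4 21)] [:: 0%N]; from 3 7 20; from 6 10 22;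
   from 2 10 19; from 2 12 18; from 6 10 16; from 2 10 18; from 1 6 10;
   from 6 20 21; from 10 20 23; from 9 19 20; from 9 18 20; from 2 11 21;
   from 8 22 24; from 9 11 22; from 2 14 23; from 3 13 23; from 1 14 18;
   from 2 9 21; from 3 14 16; from 4 13 16;
   Derivation [:: (one, Overlap 2 15 22)] [:: 3%N]; from 6 10 17; from 1 8 16;
   from 7 20 21; from 10 19 20; from 6 11 20; from 3 14 23; from 2 13 20;
   from 3 12 20; from 2 15 23; from 6 10 19; from 3 14 17; from 3 15 22;
   from 6 10 18; from 1 8 17; from 9 20 21; from 7 11 20; from 2 13 21;
   from 6 14 17; from 6 15 22; Derivation [:: (one, Overlap 4 13 19)] [:: 0%N];
   from 6 10 20; from 2 15 18; from 2 6 14; from 1 8 18; from 7 9 21;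
   from 7 15 24; Derivation [:: (one, Overlap 6 10 21)] [:: 0%N; 3%N];
   from 3 14 20; from 3 15 19;
   Derivation [:: (one, Overlap 1 10 13)] [:: 0%N; 3%N; 3%N]; from 2 8 18;
   from 7 14 19; from 9 12 20; Derivation [:: (one, Overlap 5 10 21)] [:: 0%N];
   from 6 8 23; Derivation [:: (one, Overlap 2 10 13)] [:: 0%N; 3%N; 3%N];
   from 9 13 20; from 6 8 19; from 2 10 14; from 9 14 20;
   Derivation [:: (one, Overlap 5 11 13)] [:: 0%N]; from 6 10 14; from 6 10 15].

(** * The relations of type F_4 as input data, and the evaluation of the completion *)

Definition aexp (c c' : 'I_4) : int * int :=
  nth (0, 0) (nth [::]
    [:: [:: (2, -2); (0, 2); (0, 0); (0, 0)];
        [:: (-2, 0); (2, -2); (0, 2); (0, 0)];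
        [:: (0, 0); (-2, 0); (1, -1); (0, 1)];
        [:: (0, 0); (0, 0); (-1, 0); (1, -1)]] c) c'.

(** The exponents of r and s in the pairing of omega'_{beta_j} with omega_{beta_i}, summed over all
    pairs of letters by bimultiplicativity. *)
Definition chi_exp (i j : nat) : int * int :=
  foldr (fun c e => foldr (fun c' e =>
      (e.1 + (aexp c c').1, e.2 + (aexp c c').2)) e (word j))
    (0, 0) (word i).

(* X_13, X_14 and X_15 stand for the root vectors divided by r + s, which makes
   all structure constants Laurent polynomials in r and s. *)
Definition root_scale k : laurent := if k == 13%N then r_plus_s else one.

Definition definition_rule (t : nat * nat * nat) : nat * nat * ncpoly :=
  let: (k, i, j) := t in
  (i, j, (1, (chi_exp i j, [:: j; i])) ::
    [seq (f.1.1, (f.1.2, f.2, [:: k])) | f <- root_scale k]).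

(* E_1, E_2, E_3, E_4 are X_1, X_16, X_22, X_24. *)
Definition commutation_rule (t : nat * nat) : nat * nat * ncpoly :=
  (t, [:: (1, (0, 0, [:: t.2; t.1]))]).

Definition initial_rules : seq (nat * nat * ncpoly) :=
  [seq definition_rule t | t <- root_pairs] ++
  [seq commutation_rule t | t <- [:: (1, 22); (1, 24); (16, 24)]%N].

(** The coefficient r^m + s^m takes two terms, since a term carries a single monomial. The values 2,
    -2, 1, -1 of [m] cover the five Serre relations other than the cubic one. *)
Definition quadratic_serre (m : int) (i j : nat) : ncpoly :=
  [:: (1, (0, 0, [:: i; i; j])); (-1, (m, 0, [:: i; j; i]));
      (-1, (0, m, [:: i; j; i])); (1, (m, m, [:: j; i; i]))].

Definition cubic_serre (i j : nat) : ncpoly :=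
  [:: (1, (0, 0, [:: i; i; i; j]));
      (-1, (-2, 0, [:: i; i; j; i])); (-1, (-1, -1, [:: i; i; j; i]));
      (-1, (0, -2, [:: i; i; j; i]));
      (1, (-3, -1, [:: i; j; i; i])); (1, (-2, -2, [:: i; j; i; i]));
      (1, (-1, -3, [:: i; j; i; i]));
      (-1, (-3, -3, [:: j; i; i; i]))].

Definition serre_polys : seq ncpoly :=
  [:: quadratic_serre 2 1 16; quadratic_serre (-2) 16 1;
      quadratic_serre 2 16 22; cubic_serre 22 16;
      quadratic_serre 1 22 24; quadratic_serre (-1) 24 22].

Definition root_rules : rules :=
  foldl (derive serre_polys)
    (foldr (fun t R => add_rule R t.1.1 t.1.2 t.2) [::] initial_rules) plan.

Definition height k := size (word k).

Definition straight_term i j (t : ncterm) : bool :=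
  (t.2.2 == [:: j; i]) ||
  all (fun k => i < k <= 24)%N t.2.2
    && (sumn [seq height k | k <- t.2.2] == height i + height j)%N.

(** This evaluation runs the whole completion. Only the existence and the shape of the 276 rules are
    retained, not their coefficients. *)
Lemma root_rules_straight :
  all (fun i => all (fun j => (i < j)%N ==>
    (rule root_rules i j != [::]) && all (straight_term i j) (rule root_rules i j))
    (iota 1 24)) (iota 1 24).
Proof. by vm_compute. Qed.

(** * Every computed rule holds in an algebra satisfying the input relations *)

Section Soundness.
Variables (K : fieldType) (A : algType K) (r s : K) (X : nat -> A).
Hypotheses (r_neq0 : r != 0) (s_neq0 : s != 0).

Definition laurent_mono (c a b : int) : K := c%:~R * r ^ a * s ^ b.
Definition laurent_val (f : laurent) : K :=
  \sum_(t <- f) laurent_mono t.1.1 t.1.2 t.2.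
Definition word_val (w : seq nat) : A := \prod_(k <- w) X k.
Definition term_val (t : ncterm) : A :=
  laurent_mono t.1 t.2.1.1 t.2.1.2 *: word_val t.2.2.
Definition ncval (p : ncpoly) : A := \sum_(t <- p) term_val t.

Lemma laurent_monoM c a b c' a' b' :
  laurent_mono (c * c') (a + a') (b + b') =
    laurent_mono c a b * laurent_mono c' a' b'.
Proof. by rewrite /laurent_mono intrM !expfzDr // (mulrACA c%:~R) [LHS]mulrACA. Qed.

Lemma laurent_mono1 : laurent_mono 1 0 0 = 1.
Proof. by rewrite /laurent_mono !expr0z !mulr1. Qed.

Lemma laurent_monoD c c' a b :
  laurent_mono (c + c') a b = laurent_mono c a b + laurent_mono c' a b.
Proof. by rewrite /laurent_mono intrD !mulrDl. Qed.

Lemma word_val_cat u v : word_val (u ++ v) = word_val u * word_val v.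
Proof. exact: big_cat. Qed.

Lemma word_val_pair i j : word_val [:: i; j] = X i * X j.
Proof. by rewrite /word_val !big_cons big_nil mulr1. Qed.

Lemma ncval_cat p q : ncval (p ++ q) = ncval p + ncval q.
Proof. exact: big_cat. Qed.

Lemma ncval_cons t p : ncval (t :: p) = term_val t + ncval p.
Proof. exact: big_cons. Qed.

Lemma ncval_nil : ncval [::] = 0.
Proof. exact: big_nil. Qed.

Lemma nat_cmp_eq m n : Nat.compare m n = Eq -> m = n.
Proof. by elim: m n => [|m IH] [|n] //= /IH ->. Qed.

Lemma word_cmp_eq u v : word_cmp u v = Eq -> u = v.
Proof.
elim: u v => [|i u IH] [|j v] //=.
by case E: Nat.compare => // /IH ->; rewrite (nat_cmp_eq E).
Qed.

Lemma int_cmp_eq a b : int_cmp a b = Eq -> a = b.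
Proof. by case: a b => m [] n //= /nat_cmp_eq ->. Qed.

Lemma mono_cmp_eq m n : mono_cmp m n = Eq -> m = n.
Proof.
case: m n => [[a b] u] [[a' b'] v]; rewrite /mono_cmp /=.
case Ew: word_cmp => //; case Ea: int_cmp => // Eb.
by rewrite (word_cmp_eq Ew) (int_cmp_eq Ea) (int_cmp_eq Eb).
Qed.

Lemma ncadd_cons t p t' q :
  ncadd (t :: p) (t' :: q) = match mono_cmp t.2 t'.2 with
    | Lt => t :: ncadd p (t' :: q)
    | Gt => t' :: ncadd (t :: p) q
    | Eq => if t.1 + t'.1 == 0 then ncadd p q
            else (t.1 + t'.1, t.2) :: ncadd p q
    end.
Proof. by []. Qed.

Lemma ncval_add p q : ncval (ncadd p q) = ncval p + ncval q.
Proof.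
elim: p q => [|t p IHp] q; first by rewrite ncval_nil add0r.
elim: q => [|t' q IHq]; first by rewrite ncval_nil addr0.
rewrite ncadd_cons; case E: mono_cmp; last 2 first.
- by rewrite ncval_cons IHp !ncval_cons addrA.
- by rewrite ncval_cons IHq !ncval_cons addrCA.
rewrite !ncval_cons addrACA -IHp.
have -> : term_val t + term_val t' = term_val (t.1 + t'.1, t.2).
  by rewrite /term_val (mono_cmp_eq E) /= laurent_monoD scalerDl.
case: eqP => [->|_]; last by rewrite ncval_cons.
by rewrite /term_val /laurent_mono !mul0r scale0r add0r.
Qed.

Lemma ncval_pair ps : \sum_(p <- ncpair ps) ncval p = \sum_(p <- ps) ncval p.
Proof.
have [n] := ubnP (size ps); elim: n ps => // n IH [|p [|q ps]] //= le_n.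
by rewrite !big_cons IH ?ncval_add ?addrA // ltnW.
Qed.

Lemma ncval_sort p : ncval (ncsort p) = ncval p.
Proof.
have foldE ps : ncval (foldr ncadd [::] ps) = \sum_(q <- ps) ncval q.
  elim: ps => [|q ps IH] /=; first by rewrite ncval_nil big_nil.
  by rewrite ncval_add IH big_cons.
rewrite /ncsort foldE; elim: 12%N => [|n IH]; last by rewrite iterS ncval_pair.
by rewrite big_map; apply: eq_bigr => t _; rewrite /ncval big_seq1.
Qed.

Lemma ncval_mul c a b u v p :
  ncval (ncmul c a b u v p) =
    laurent_mono c a b *: (word_val u * ncval p * word_val v).
Proof.
rewrite /ncval big_map mulr_sumr mulr_suml scaler_sumr.
apply: eq_bigr => t _; rewrite /term_val /= laurent_monoM !word_val_cat.
by rewrite -scalerAr -scalerAl scalerA mulrA.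
Qed.

Lemma ncval_flatten ps : ncval (flatten ps) = \sum_(p <- ps) ncval p.
Proof.
elim: ps => [|p ps IH] /=; first by rewrite ncval_nil big_nil.
by rewrite ncval_cat IH big_cons.
Qed.

Lemma ncval_scale f p : ncval (ncscale f p) = laurent_val f *: ncval p.
Proof.
rewrite ncval_sort ncval_flatten big_map scaler_suml.
by apply: eq_bigr => t _; rewrite ncval_mul /word_val !big_nil mul1r mulr1.
Qed.

Definition sound (R : rules) :=
  forall i j, rule R i j <> [::] -> X i * X j = ncval (rule R i j).

Lemma rule_add R i j p i' j' :
  rule (add_rule R i j p) i' j' = if (i' == i) && (j' == j) then p else rule R i' j'.
Proof.
rewrite /rule /add_rule nth_set_nth /=; case: (i' =P i) => //= ->.
by rewrite nth_set_nth /=; case: eqP.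
Qed.

Lemma sound_add R i j p :
  sound R -> X i * X j = ncval p -> sound (add_rule R i j p).
Proof.
by move=> sR ep i' j'; rewrite rule_add; case: andP => [[/eqP -> /eqP ->]|_ /sR].
Qed.

Lemma reduce_wordE R c a b u w q : sound R ->
  reduce_word R c a b u w = Some q ->
  ncval q = laurent_mono c a b *: word_val (u ++ w).
Proof.
move=> sR; elim: w u => [|i [|j v] IH] //= u.
have := sR i j; case E: (rule R i j) => [|t p] sij.
  by move/IH ->; rewrite -cats1 -catA.
move/Some_inj <-; rewrite ncval_mul -sij // -word_val_pair -!word_val_cat -catA.
by [].
Qed.

Lemma reduceE n R p : sound R -> ncval (reduce n R p) = ncval p.
Proof.
move=> sR; elim: n p => //= n IH p.
have split_p : ncval p = ncval [seq t <- p | ~~ reduce_term R t]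
    + ncval (flatten (pmap (reduce_term R) p)).
  elim: p => [|t p IHp]; first by rewrite ncval_nil addr0.
  rewrite ncval_cons IHp /=; case E: (reduce_term R t) => [q|] /=.
    by rewrite ncval_cat (reduce_wordE sR E) addrCA.
  by rewrite ncval_cons addrA.
case E: (pmap _ _) => [//|q qs].
by rewrite ncval_add IH ncval_sort -E -split_p.
Qed.

Lemma monic_ruleE R i j : sound R -> ncval (monic_rule R i j) = X i * X j.
Proof.
move=> sR; rewrite /monic_rule; have := sR i j.
case: (rule R i j) => [_|t p -> //].
by rewrite ncval_cons ncval_nil addr0 /term_val /= laurent_mono1 scale1r word_val_pair.
Qed.

(** An overlap vanishes by associativity: both of its halves have the value X_i X_j X_k. *)
Lemma relation_poly0 zs R x : (forall z, z \in zs -> ncval z = 0) -> sound R ->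
  ncval (relation_poly zs R x) = 0.
Proof.
move=> zs0 sR; case: x => [n|i j k] /=.
  case: (ltnP n (size zs)) => [lt_n|ge_n]; first exact/zs0/mem_nth.
  by rewrite nth_default // ncval_nil.
rewrite ncval_cat !ncval_mul !monic_ruleE // /word_val !big_seq1 !big_nil mul1r mulr1.
by rewrite mulrA -scalerDl -laurent_monoD /laurent_mono subrr !mul0r scale0r.
Qed.

Hypothesis factors_neq0 : forall f, f \in factors -> laurent_val f != 0.

(** The combination z has value 0, and the check in [derive] says that z is q times the
    denominators. These are nonzero scalars, so q has value 0 and can be solved for its only
    disordered term. *)
Lemma sound_derive zs R d : (forall z, z \in zs -> ncval z = 0) -> sound R ->
  sound (derive zs R d).
Proof.
move=> zs0 sR; rewrite /derive; set z := reduce _ _ _; set fs := map _ _.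
set q := foldl _ z fs; case: eqP => // qz.
have z0 : ncval z = 0.
  rewrite reduceE // ncval_sort ncval_flatten big_map big1 // => x _.
  by rewrite ncval_scale relation_poly0 // scaler0.
have fs_neq0 f : f \in fs -> laurent_val f != 0.
  case/mapP=> k _ ->; case: (ltnP k (size factors)) => [lt_k|ge_k].
    exact/factors_neq0/mem_nth.
  (* An index outside [factors] selects the default [one], whose value is 1. *)
  by rewrite nth_default // /laurent_val big_seq1 laurent_mono1 oner_eq0.
have {z0 qz} q0 : ncval q = 0.
  move: z0; rewrite -qz; clearbody q; clear qz.
  elim: fs q fs_neq0 => //= f fs IH q fs_neq0.
  have fs_neq0' g : g \in fs -> laurent_val g != 0.
    by move=> gfs; apply: fs_neq0; rewrite inE gfs orbT.
  move/(IH _ fs_neq0'); rewrite ncval_scale => /eqP.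
  by rewrite scaler_eq0 (negbTE (fs_neq0 f (mem_head _ _))) => /eqP.
have : ncval q = ncval [seq t <- q | disordered t]
    + ncval [seq t <- q | ~~ disordered t].
  by rewrite /ncval !big_filter (bigID disordered).
case: filter => [|[c [[a b] [|i [|j [|? ?]]]]] [|? ?]] //; case: eqP => // cc.
rewrite q0 ncval_cons ncval_nil addr0 /term_val /= word_val_pair => /esym/eqP.
rewrite addr_eq0 => /eqP e; apply: sound_add => //; rewrite ncval_mul.
rewrite /word_val !big_nil mul1r mulr1 -[ncval _]opprK -e scalerN scalerA.
have -> : laurent_mono (- c) (- a) (- b) * laurent_mono c a b = -1.
  by rewrite -laurent_monoM mulNr cc !addNr /laurent_mono !mulr1.
by rewrite scaleN1r opprK.
Qed.

Lemma quadratic_serreE m i j : ncval (quadratic_serre m i j) =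
  X i * X i * X j - (r ^ m + s ^ m) *: (X i * X j * X i)
  + (r ^ m * s ^ m) *: (X j * X i * X i).
Proof.
rewrite /quadratic_serre !ncval_cons ncval_nil addr0 /term_val /word_val.
rewrite !big_cons !big_nil !mulr1 !mulrA /laurent_mono /= !expr0z !mulr1 !mul1r scale1r.
by rewrite !mulN1r scalerDl opprD -!scaleNr !addrA.
Qed.

Lemma cubic_serreE i j : ncval (cubic_serre i j) =
  let q := r ^ (-2) + r ^ (-1) * s ^ (-1) + s ^ (-2) in
  X i * X i * X i * X j - q *: (X i * X i * X j * X i)
  + (r ^ (-1) * s ^ (-1) * q) *: (X i * X j * X i * X i)
  - (r ^ (-3) * s ^ (-3)) *: (X j * X i * X i * X i).
Proof.
rewrite /cubic_serre !ncval_cons ncval_nil addr0 /term_val /word_val.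
rewrite !big_cons !big_nil !mulr1 !mulrA /laurent_mono /= !expr0z !mulr1 !mul1r scale1r.
(* Once negative powers are written as products of r^-1 and s^-1, this is a polynomial identity in
   these two elements. *)
have -> : r ^ (-1) * s ^ (-1) * (r ^ (-2) + r ^ (-1) * s ^ (-1) + s ^ (-2))
    = r ^ (-3) * s ^ (-1) + r ^ (-2) * s ^ (-2) + r ^ (-1) * s ^ (-3).
  have e x : x != 0 -> (x ^ (-2) = x ^ (-1) * x ^ (-1) :> K)
      * (x ^ (-3) = x ^ (-1) * x ^ (-1) * x ^ (-1) :> K).
    by move=> x0; rewrite -!expfzDr.
  by rewrite !(e r) // !(e s) //; ring.
by rewrite !mulN1r !mulNr !scaleNr !scalerDl !opprD !addrA.
Qed.

Lemma quadratic_serre0 (E : 'I_4 -> A) m i j c c' a b :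
  X i = E c -> X j = E c' -> a = r ^ m + s ^ m -> b = r ^ m * s ^ m ->
  \sum_(t <- [:: (1, [:: c; c; c']); (- a, [:: c; c'; c]); (b, [:: c'; c; c])])
    t.1 *: \prod_(e <- t.2) E e = 0 ->
  ncval (quadratic_serre m i j) = 0.
Proof.
move=> ei ej -> -> <-; rewrite quadratic_serreE ei ej !big_cons !big_nil /=.
by rewrite !mulr1 !mulrA addr0 scale1r scaleNr addrA.
Qed.

Lemma cubic_serre0 (E : 'I_4 -> A) i j c c' (q := r ^- 2 + r^-1 * s^-1 + s ^- 2) :
  X i = E c -> X j = E c' ->
  \sum_(t <- [:: (1, [:: c; c; c; c']); (- q, [:: c; c; c'; c]);
                 (r^-1 * s^-1 * q, [:: c; c'; c; c]);
                 (- (r ^- 3 * s ^- 3), [:: c'; c; c; c])])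
    t.1 *: \prod_(e <- t.2) E e = 0 ->
  ncval (cubic_serre i j) = 0.
Proof.
move=> ei ej <-; rewrite cubic_serreE ei ej !big_cons !big_nil /=.
by rewrite !mulr1 !mulrA addr0 scale1r !scaleNr !addrA.
Qed.

Lemma sound_rules (L : seq (nat * nat * ncpoly)) zs ds :
  (forall t, t \in L -> X t.1.1 * X t.1.2 = ncval t.2) ->
  (forall z, z \in zs -> ncval z = 0) ->
  sound (foldl (derive zs)
    (foldr (fun t R => add_rule R t.1.1 t.1.2 t.2) [::] L) ds).
Proof.
move=> hL zs0; have: sound (foldr (fun t R => add_rule R t.1.1 t.1.2 t.2) [::] L).
  elim: L hL => [_ i j|t L IH hL] /=; first by rewrite /rule !nth_nil.
  apply: sound_add; last by apply: hL; rewrite mem_head.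
  by apply: IH => t' ht'; apply: hL; rewrite inE ht' orbT.
elim: ds (foldr _ _ _) => //= d ds IH R sR.
by apply/IH/sound_derive.
Qed.

End Soundness.

(** * Straightening and nilpotency bound the weight of nonzero elements *)

Section Straightening.
Variables (K : fieldType) (A : algType K) (X : nat -> A) (N : nat) (wt : nat -> nat).

(* Combinations of words of weight n in the X k with i < k <= N, the scalars
   being the words of weight 0. *)
Inductive word_span (i : nat) : nat -> A -> Prop :=
| WordSpan0 n : word_span i n 0
| WordSpanC (c : K) : word_span i 0 c%:A
| WordSpanD n x y : word_span i n x -> word_span i n y -> word_span i n (x + y)
| WordSpanX n k x : (i < k <= N)%N -> word_span i n x ->
    word_span i (wt k + n) (X k * x).

Lemma word_span1 i : word_span i 0 1.
Proof. by rewrite -[1]scale1r; apply: WordSpanC. Qed.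

Lemma word_spanZ i n c x : word_span i n x -> word_span i n (c *: x).
Proof.
elim=> {n x} [n|b|n x y _ IHx _ IHy|n k x hk _ IH].
- by rewrite scaler0; apply: WordSpan0.
- by rewrite scalerA; apply: WordSpanC.
- by rewrite scalerDr; apply: WordSpanD.
- by rewrite scalerAr; apply: WordSpanX.
Qed.

Lemma word_spanM i m n x y :
  word_span i m x -> word_span i n y -> word_span i (m + n) (x * y).
Proof.
move=> hx hy; elim: hx => {m x} [m|b|m x x' _ IHx _ IHx'|m k x hk _ IH].
- by rewrite mul0r; apply: WordSpan0.
- by rewrite mulr_algl; apply: word_spanZ.
- by rewrite mulrDl; apply: WordSpanD.
- by rewrite -mulrA -addnA; apply: WordSpanX.
Qed.

Lemma word_span_gen i k : (i < k <= N)%N -> word_span i (wt k) (X k).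
Proof.
by move=> hk; rewrite -[X k]mulr1 -[wt k]addn0; apply/WordSpanX/word_span1.
Qed.

Lemma word_spanXn i k m x : word_span i k x -> word_span i (m * k) (x ^+ m).
Proof.
move=> hx; elim: m => [|m IH]; first exact: word_span1.
by rewrite exprS mulSn; apply: word_spanM.
Qed.

Lemma word_span_val i w : all (fun k => i < k <= N)%N w ->
  word_span i (sumn [seq wt k | k <- w]) (word_val X w).
Proof.
rewrite /word_val; elim: w => [_|k w IH /andP[hk hw]].
  by rewrite big_nil; apply: word_span1.
by rewrite big_cons; apply: WordSpanX => //; apply: IH.
Qed.

Lemma word_span_straight (r s : K) i j (p : ncpoly) :
  all (fun t : ncterm => (t.2.2 == [:: j; i]) ||
    all (fun k => i < k <= N)%N t.2.2
      && (sumn [seq wt k | k <- t.2.2] == wt i + wt j)%N) p ->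
  exists c u, ncval r s X p = c *: (X j * X i) + u /\ word_span i (wt i + wt j) u.
Proof.
elim: p => [_|t p IH /= /andP[ht /IH[c [u [e hu]]]]].
  exists 0, 0; rewrite ncval_nil scale0r addr0; split=> //; exact: WordSpan0.
rewrite ncval_cons e /term_val; case/orP: ht => [/eqP ->|/andP[hw /eqP ew]].
  exists (laurent_mono r s t.1 t.2.1.1 t.2.1.2 + c), u.
  by rewrite word_val_pair addrA -scalerDl.
exists c, (laurent_mono r s t.1 t.2.1.1 t.2.1.2 *: word_val X t.2.2 + u).
split; first by rewrite addrCA.
apply: WordSpanD => //; apply: word_spanZ.
by rewrite -ew; apply: word_span_val.
Qed.

Hypothesis straighten : forall i j, (0 < i)%N -> (i < j <= N)%N ->
  exists c u, X i * X j = c *: (X j * X i) + u /\ word_span i (wt i + wt j) u.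

(* Combinations, of weight n, of the x * X i ^+ a with x spanned by words in the
   X k with k > i. *)
Inductive power_span (i : nat) : nat -> A -> Prop :=
| PowerSpan0 n : power_span i n 0
| PowerSpanD n x y : power_span i n x -> power_span i n y -> power_span i n (x + y)
| PowerSpanX n a x : word_span i n x -> power_span i (n + a * wt i) (x * X i ^+ a).

Lemma power_span_word i n x : word_span i n x -> power_span i n x.
Proof. by move=> hx; rewrite -[n]addn0 -[x]mulr1; apply: (PowerSpanX 0). Qed.

Lemma power_span_mull i m n x y :
  word_span i m x -> power_span i n y -> power_span i (m + n) (x * y).
Proof.
move=> hx; elim=> {n y} [n|n y z _ IHy _ IHz|n a y hy].
- by rewrite mulr0; apply: PowerSpan0.
- by rewrite mulrDr; apply: PowerSpanD.
- by rewrite mulrA addnA; apply/PowerSpanX/word_spanM.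
Qed.

(** As in an Ore extension, X_i moves to the right past one letter at a time; each exchange X_i X_k
    = c X_k X_i + u leaves a remainder without X_i. *)
Lemma mul_gen_word i n x : (0 < i)%N -> word_span i n x ->
  exists y z, [/\ X i * x = y * X i + z, word_span i n y & word_span i (wt i + n) z].
Proof.
move=> i_gt0; elim=> {n x} [n|b|n x x' _ [y [z [e hy hz]]] _ [y' [z' [e' hy' hz']]]
                           |n k x hk hx [y [z [e hy hz]]]].
- by exists 0, 0; rewrite mul0r mulr0 addr0; split=> //; apply: WordSpan0.
- exists b%:A, 0; rewrite mulr_algl mulr_algr addr0; split=> //.
    exact: WordSpanC.
  exact: WordSpan0.
- exists (y + y'), (z + z'); split; try exact: WordSpanD.
  by rewrite mulrDr e e' mulrDl addrACA.
- have [c [u [eu hu]]] := straighten i_gt0 hk.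
  exists (c *: (X k * y)), (c *: (X k * z) + u * x); split.
  + rewrite mulrA eu mulrDl -scalerAl -mulrA e mulrDr scalerDr -scalerAl mulrA.
    by rewrite addrA.
  + exact/word_spanZ/WordSpanX.
  + apply: WordSpanD; last by rewrite addnA; apply: word_spanM.
    by rewrite addnCA; apply/word_spanZ/WordSpanX.
Qed.

(** The span of the x X_{i+1}^a is stable under left multiplication by the letters above i + 1, and
    by X_{i+1} itself thanks to [mul_gen_word]. *)
Lemma word_span_power i n x : word_span i n x -> power_span i.+1 n x.
Proof.
elim=> {n x} [n|c|n x y _ IHx _ IHy|n k x hk _].
- exact: PowerSpan0.
- exact/power_span_word/WordSpanC.
- exact: PowerSpanD.
case/andP: hk => lt_ik le_kN; move: lt_ik; rewrite leq_eqVlt => /predU1P[<-|lt_ik].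
  elim=> {n x} [n|n y z _ IHy _ IHz|n a y hy].
  - by rewrite mulr0; apply: PowerSpan0.
  - by rewrite mulrDr; apply: PowerSpanD.
  have [y1 [y2 [e h1 h2]]] := mul_gen_word (ltn0Sn i) hy.
  rewrite mulrA e mulrDl -mulrA -exprS; apply: PowerSpanD.
    by rewrite addnCA -mulSn; apply: PowerSpanX.
  by rewrite addnA; apply: PowerSpanX.
move=> hx; apply: power_span_mull hx; apply: word_span_gen; first by rewrite lt_ik.
Qed.

Variable l : nat.
Hypothesis nilpotent : forall k, (0 < k <= N)%N -> X k ^+ l = 0.

Lemma word_span_bound i n x : word_span i n x ->
  (l.-1 * \sum_(i.+1 <= k < N.+1) wt k < n)%N -> x = 0.
Proof.
have [m] := ubnP (N - i); elim: m i n x => // m IH i n x lt_m hx lt_n.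
case: (ltnP i N) => [lt_iN|le_Ni].
  have {hx} := word_span_power hx; move: lt_n; rewrite big_ltn //.
  move=> lt_n hx; elim: hx lt_n => {n x} [n|n x y _ IHx _ IHy|n a x hx] // lt_n.
    by rewrite IHx // IHy // addr0.
  (* For a >= l the power vanishes. For a <= l - 1 the power accounts for at most (l - 1) wt (i + 1)
     of the weight, so x still exceeds the bound for i + 1. *)
  case: (leqP l a) => [le_la|lt_al].
    by rewrite -(subnK le_la) exprD nilpotent ?mulr0.
  rewrite (IH i.+1 n x) ?mul0r //; first by rewrite -ltnS subnSK.
  move: lt_n; rewrite mulnDr addnC => lt_n.
  rewrite -(ltn_add2r (a * wt i.+1)); apply: leq_ltn_trans lt_n.
  rewrite leq_add2l leq_mul2r -ltnS prednK ?lt_al ?orbT //.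
  exact: leq_ltn_trans lt_al.
(* For i >= N no letters are left; scalars have weight 0 and cannot exceed the bound. *)
elim: hx lt_n => // {n x} [n x y _ IHx _ IHy lt_n|n k x /andP[lt_ik le_kN]].
  by rewrite IHx // IHy // addr0.
by have := leq_trans lt_ik (leq_trans le_kN le_Ni); rewrite ltnn.
Qed.

End Straightening.

(** * Recursive families indexed by the positive roots *)

Section RootFamily.
Variables (T : Type) (g : 'I_4 -> T) (dflt : T) (br : nat -> nat -> T -> T -> T).
Local Notation fam := (root_family dflt g br).

(** The check [wf] says that no index of a triple is redefined by a later triple, so the values read
    when v_k is set are already final. *)
Lemma root_family_pair k i j :
  (k, i, j) \in root_pairs -> fam k = br i j (fam i) (fam j).
Proof.
rewrite /root_family; set f0 := fun n : nat => _; set st := (fun _ _ => _).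
pose wf := fix wf (ps : seq (nat * nat * nat)) := if ps is (k, i, j) :: ps' then
  all (fun n => n \notin [seq t.1.1 | t <- ps']) [:: k; i; j] &&
  ((k != i) && (k != j)) && wf ps' else true.
have : wf root_pairs by vm_compute.
have keep (ps : seq (nat * nat * nat)) f n :
    n \notin [seq t.1.1 | t <- ps] -> foldl st f ps n = f n.
  elim: ps f => //= [[[k' i'] j'] ps] IH f.
  by rewrite inE negb_or => /andP[/negbTE nk /IH ->]; rewrite /= nk.
elim: root_pairs f0 => //= [[[k' i'] j'] ps] IH f0.
case/andP=> /andP[/and4P[hk hi hj _] /andP[nki nkj]] wf_ps.
rewrite inE => /predU1P[[-> -> ->]|]; last exact: IH.
by rewrite !keep //= eqxx eq_sym (negbTE nki) eq_sym (negbTE nkj).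
Qed.
Lemma root_family_ind (P : T -> Prop) : P dflt -> (forall c, P (g c)) ->
  (forall i j x y, P x -> P y -> P (br i j x y)) -> forall k, P (fam k).
Proof.
move=> P0 Pg Pbr; rewrite /root_family; set f0 := fun n : nat => _.
have : forall k, P (f0 k) by move=> k; rewrite /f0; do 4![case: ifP => // _].
elim: root_pairs f0 => // [[[k i] j]] ps IH f0 h0 /=.
by apply: IH => n; case: ifP => // _; apply: Pbr.
Qed.
End RootFamily.

(** * Geometric sums and elements that intertwine them *)

Section Intertwining.
Variable R : pzRingType.
Implicit Types e w : R.

Lemma mulr_geometric w l : (0 < l)%N -> w ^+ l = 1 ->
  w * (\sum_(j < l) w ^+ j) = \sum_(j < l) w ^+ j.
Proof.
case: l => // n _ wn; rewrite mulr_sumr big_ord_recr -exprS /= wn.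
rewrite [RHS]big_ord_recl expr0 addrC; congr (_ + _).
by apply: eq_bigr => j _; rewrite -exprS.
Qed.

(** With w' = w this serves for the commuting omega_k, and with w' a multiple of w for omega_k and
    E_i. *)
Lemma intertwine_geometric e w w' n : e * w = w' * e ->
  e * (\sum_(j < n) w ^+ j) = (\sum_(j < n) w' ^+ j) * e.
Proof.
move=> ew; rewrite mulr_sumr mulr_suml; apply: eq_bigr => j _.
elim: (val j) => [|k IH]; first by rewrite mulr1 mul1r.
by rewrite exprSr mulrA IH -mulrA ew mulrA -exprSr.
Qed.

Lemma intertwine_prod (I : Type) (L : seq I) (F F' : I -> R) e :
  (forall i, e * F i = F' i * e) ->
  e * (\prod_(i <- L) F i) = (\prod_(i <- L) F' i) * e.
Proof.
move=> eF; elim: L => [|i L IH]; first by rewrite !big_nil mulr1 mul1r.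
by rewrite !big_cons mulrA eF -mulrA IH mulrA.
Qed.

Lemma mulr_prod_absorb (I : eqType) (L : seq I) (F : I -> R) w i : i \in L ->
  (forall j, w * F j = F j * w) -> w * F i = F i ->
  w * (\prod_(j <- L) F j) = \prod_(j <- L) F j.
Proof.
move=> iL wF wi; elim: L iL => // j L IH; rewrite inE big_cons => /predU1P[<-|iL].
  by rewrite mulrA wi.
by rewrite mulrA wF -mulrA IH.
Qed.

End Intertwining.

(** * Closure properties of subalgebras *)

Section Closure.
Variables (K : fieldType) (A : algType K).

(** [subalgebra] over an abstract algebra; on [urs] the two are convertible. *)
Definition closed_subalgebra (B : A -> Prop) :=
  [/\ B 1, forall (k : K) x y, B x -> B y -> B (k *: x + y)
         & forall x y, B x -> B y -> B (x * y)].

Section Generated.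
Variable B : A -> Prop.
Hypothesis closedB : closed_subalgebra B.

Lemma closed_subalgebra0 : B 0.
Proof.
by case: closedB => B1 Bl _; rewrite -[0](addNr (1 : A)) -scaleN1r; apply: Bl.
Qed.

Lemma closed_subalgebraB k x y : B x -> B y -> B (x - k *: y).
Proof. by case: closedB => _ Bl _ Bx By; rewrite addrC -scaleNr; apply: Bl. Qed.

Lemma closed_subalgebraX x n : B x -> B (x ^+ n).
Proof.
case: closedB => B1 _ BM Bx; elim: n => // n IH.
by rewrite exprS; apply: BM.
Qed.

Lemma closed_subalgebra_sum (I : Type) (L : seq I) (F : I -> A) :
  (forall i, B (F i)) -> B (\sum_(i <- L) F i).
Proof.
case: closedB => _ Bl _ BF; elim: L => [|i L IH].
  by rewrite big_nil; apply: closed_subalgebra0.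
by rewrite big_cons -[F i]scale1r; apply: Bl.
Qed.

Lemma closed_subalgebra_prod (I : Type) (L : seq I) (F : I -> A) :
  (forall i, B (F i)) -> B (\prod_(i <- L) F i).
Proof.
case: closedB => B1 _ BM BF; elim: L => [|i L IH]; first by rewrite big_nil.
by rewrite big_cons; apply: BM.
Qed.

End Generated.

Variable eps : {lrmorphism A -> K^o}.

(** By [frakb_subalgebra], this reduces the condition on a left integral to the generators of b. *)
Lemma left_integrating_closed y :
  closed_subalgebra (fun a => a * y = (eps a : K) *: y).
Proof.
split=> [|k a b ea eb|a b ea eb]; first by rewrite rmorph1 scale1r mul1r.
  by rewrite linearP mulrDl -scalerAl ea eb scalerA scalerDl.
by rewrite rmorphM -mulrA eb -scalerAr ea scalerA mulrC.
Qed.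

Lemma right_integrating_closed y :
  closed_subalgebra (fun a => y * a = (eps a : K) *: y).
Proof.
split=> [|k a b ea eb|a b ea eb]; first by rewrite rmorph1 scale1r mulr1.
  by rewrite linearP mulrDr -scalerAr ea eb scalerA scalerDl.
by rewrite rmorphM mulrA ea -scalerAl eb scalerA.
Qed.

End Closure.

(** Turns the definition of a root vector z into a rule for rescaled vectors; [d] makes up for the
    change of scale. *)
Lemma scaled_commutator (K : fieldType) (A : algType K) (x y z : A) (a b c d p : K) :
  z = x * y - p *: (y * x) -> d * c = a * b ->
  (a *: x) * (b *: y) = p *: ((b *: y) * (a *: x)) + d *: (c *: z).
Proof.
move=> -> e.
have -> : (a *: x) * (b *: y) = (a * b) *: (x * y).
  by rewrite -scalerAl -scalerAr scalerA.
have -> : (b *: y) * (a *: x) = (a * b) *: (y * x).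
  by rewrite -scalerAl -scalerAr scalerA mulrC.
by rewrite !scalerA e scalerBr scalerA [p * _]mulrC addrC subrK.
Qed.

(** * Root vectors, the torus sum and the integrals in the small quantum group *)

Section RootVectors.
Variables (K : fieldType) (r s : K) (l : nat) (l_odd : odd l).
Hypotheses (r_neq0 : r != 0) (s_neq0 : s != 0).
Local Notation U := (urs r s l_odd).
Local Notation gE i := (ugen r s l_odd (GE i)).
Local Notation gw i := (ugen r s l_odd (Gw i)).
Local Notation gwV i := (ugen r s l_odd (GwV i)).
Local Notation rootv := (urootE r s l_odd).

Local Notation pi_free := (free_to_u r s l_odd).

Lemma free_to_uM (x y : freeAlg K gen) : pi_free (x * y) = pi_free x * pi_free y.
Proof. by rewrite /free_to_u /upi !rmorphM. Qed.

Lemma free_to_u1 : pi_free 1 = 1.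
Proof. by rewrite /free_to_u /upi !rmorph1. Qed.

Lemma free_to_u0 : pi_free 0 = 0.
Proof. by rewrite /free_to_u /upi !raddf0. Qed.

Lemma free_to_uD (x y : freeAlg K gen) : pi_free (x + y) = pi_free x + pi_free y.
Proof. by rewrite /free_to_u /upi !raddfD. Qed.

Lemma free_to_uZ k (x : freeAlg K gen) : pi_free (k *: x) = k *: pi_free x.
Proof.
rewrite /free_to_u /upi.
by rewrite -[augPi _ x]/((augPi (@U_rel_eps K r s) : {lrmorphism _ -> _}) x) !linearZ.
Qed.

Lemma free_to_u_eq (x y : freeAlg K gen) :
  U_rel r s (x - y) -> pi_free x = pi_free y.
Proof.
move=> hxy; rewrite /free_to_u; congr upi; exact/augPiP/ideal_rel.
Qed.

Lemma upiM (x y : Urs r s) : upi l_odd (x * y) = upi l_odd x * upi l_odd y.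
Proof. exact: rmorphM. Qed.

Lemma upiB (x y : Urs r s) : upi l_odd (x - y) = upi l_odd x - upi l_odd y.
Proof. exact: raddfB. Qed.

Lemma upiZ k (x : Urs r s) : upi l_odd (k *: x) = k *: upi l_odd x.
Proof. exact: linearZ. Qed.

Lemma upiX (x : Urs r s) n : upi l_odd (x ^+ n) = upi l_odd x ^+ n.
Proof. exact: rmorphXn. Qed.

Lemma upi0 : upi l_odd (0 : Urs r s) = 0.
Proof. exact: raddf0. Qed.

Lemma upi1 : upi l_odd (1 : Urs r s) = 1.
Proof. exact: rmorph1. Qed.

Lemma upi_eq (x y : Urs r s) : u_rel l (x - y) -> upi l_odd x = upi l_odd y.
Proof. by move=> hxy; apply/augPiP/ideal_rel. Qed.

Lemma aa_neq0 i j : aa r s i j != 0.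
Proof.
have nz := (r_neq0, s_neq0).
case: i => [[|[|[|[|i]]]]] // ?; case: j => [[|[|[|[|j]]]]] // ?;
by rewrite /aa /= ?oner_eq0 ?mulf_neq0 ?invr_neq0 ?expf_neq0 ?nz.
Qed.

Lemma torusC x y : is_torus x -> is_torus y ->
  ugen r s l_odd x * ugen r s l_odd y = ugen r s l_odd y * ugen r s l_odd x.
Proof.
move=> hx hy; apply: etrans (esym (free_to_uM (freeVar x) (freeVar y))) _.
exact: etrans (free_to_u_eq (RelTorus r s hx hy)) (free_to_uM _ _).
Qed.

Lemma omegaK i : gw i * gwV i = 1.
Proof. by have := free_to_u_eq (RelW r s i); rewrite free_to_uM free_to_u1. Qed.

Lemma omegaE i j : gw i * gE j = aa r s i j *: (gE j * gw i).
Proof.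
have : gw i * gE j * gwV i = aa r s i j *: gE j.
  by have := free_to_u_eq (RelWE r s i j); rewrite free_to_uZ 2!free_to_uM.
move/(congr1 (fun x => x * gw i)); rewrite -mulrA.
by rewrite (torusC (x := GwV i)) // omegaK mulr1 -scalerAl.
Qed.

Lemma genEC (i j : 'I_4) : (i.+1 < j)%N || (j.+1 < i)%N -> gE i * gE j = gE j * gE i.
Proof.
move=> hij; apply: etrans (esym (free_to_uM (freeVar (GE i)) (freeVar (GE j)))) _.
exact: etrans (free_to_u_eq (RelEE r s hij)) (free_to_uM _ _).
Qed.

Lemma serreE p : p \in serre r s ->
  \sum_(t <- p) t.1 *: \prod_(c <- t.2) gE c = 0.
Proof.
move=> /RelSerreE; rewrite -[X in U_rel _ _ X]subr0 => /free_to_u_eq.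
rewrite free_to_u0 (big_morph _ free_to_uD free_to_u0) => h; rewrite -[RHS]h.
apply: eq_bigr => t _; rewrite free_to_uZ (big_morph _ free_to_uM free_to_u1).
by [].
Qed.

Lemma omega_pow i : gw i ^+ l = 1.
Proof. by have := upi_eq (RelWpow r s l i); rewrite upiX upi1. Qed.

Lemma rootv_pow k : (0 < k <= 24)%N -> rootv k ^+ l = 0.
Proof.
move=> /(@RelEpow _ r s l); rewrite -[X in u_rel _ X]subr0 => /upi_eq.
by rewrite upiX upi0.
Qed.

Lemma rootv_simple :
  [/\ rootv 1 = gE i1, rootv 16 = gE i2, rootv 22 = gE i3 & rootv 24 = gE i4].
Proof. by []. Qed.

Lemma rootv_pair k i j : (k, i, j) \in root_pairs ->
  rootv k = rootv i * rootv j
    - rs_pairing r s (beta j) (beta i) *: (rootv j * rootv i).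
Proof.
move=> hk; have e : Defs.rootE r s k = Defs.rootE r s i * Defs.rootE r s j
    - rs_pairing r s (beta j) (beta i) *: (Defs.rootE r s j * Defs.rootE r s i).
  exact: (root_family_pair (fun c => Ugen r s (GE c)) 0
    (fun i j x y => x * y - rs_pairing r s (beta j) (beta i) *: (y * x)) hk).
rewrite /urootE; apply: etrans (congr1 (upi l_odd) e) (etrans (upiB _ _) _).
apply: (f_equal2 (fun x y : U => x - y)); first exact: upiM.
by apply: etrans (upiZ _ _) _; congr (_ *: _); apply: upiM.
Qed.

Lemma aaE (i j : 'I_4) : aa r s i j = r ^ (aexp i j).1 * s ^ (aexp i j).2.
Proof.
case: i => [[|[|[|[|i]]]]] // ?; case: j => [[|[|[|[|j]]]]] // ?;
by rewrite /aa /aexp /= ?mulr1 ?mul1r.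
Qed.

Lemma rs_pairing0l zeta : rs_pairing r s 0 zeta = 1.
Proof.
by rewrite /rs_pairing big1 // => i _; rewrite big1 // => j _; rewrite ffunE mulr0.
Qed.

Lemma rs_pairing0r eta : rs_pairing r s eta 0 = 1.
Proof.
by rewrite /rs_pairing big1 // => i _; rewrite big1 // => j _; rewrite ffunE mul0r.
Qed.

Lemma rs_pairingDl eta eta' zeta : rs_pairing r s (eta + eta') zeta =
  rs_pairing r s eta zeta * rs_pairing r s eta' zeta.
Proof.
rewrite /rs_pairing -big_split; apply: eq_bigr => i _.
rewrite -big_split; apply: eq_bigr => j _.
by rewrite ffunE mulrDr expfzDr ?aa_neq0.
Qed.

Lemma rs_pairingDr eta zeta zeta' : rs_pairing r s eta (zeta + zeta') =
  rs_pairing r s eta zeta * rs_pairing r s eta zeta'.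
Proof.
rewrite /rs_pairing -big_split; apply: eq_bigr => i _.
rewrite -big_split; apply: eq_bigr => j _.
by rewrite ffunE mulrDl expfzDr ?aa_neq0.
Qed.

Lemma rs_pairing_simple c c' :
  rs_pairing r s (simpleRoot c') (simpleRoot c) = aa r s c c'.
Proof.
rewrite /rs_pairing (bigD1 c) //= (bigD1 c') //= !ffunE !eqxx mulr1.
rewrite !big1 ?mulr1 // => [i nci|j ncj].
  by rewrite big1 // => j _; rewrite !ffunE (negbTE nci) mul0r.
by rewrite !ffunE (negbTE ncj) mulr0.
Qed.

(** The pairing is bimultiplicative, so an induction on both words reduces it to simple roots. *)
Lemma rs_pairing_beta i j :
  rs_pairing r s (beta j) (beta i) = r ^ (chi_exp i j).1 * s ^ (chi_exp i j).2.
Proof.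
rewrite /beta /chi_exp; elim: (word i) => [|c u IH] /=.
  by rewrite big_nil rs_pairing0r mulr1.
rewrite big_cons rs_pairingDr {}IH; set e := foldr _ _ u.
elim: (word j) => [|c' v IH] /=; first by rewrite big_nil rs_pairing0l mul1r.
rewrite big_cons rs_pairingDl rs_pairing_simple -mulrA {}IH aaE.
by rewrite !expfzDr // mulrACA; congr (_ * _); apply: mulrC.
Qed.

Definition scale k : K := if k \in [:: 13; 14; 15]%N then (r + s)^-1 else 1.
Definition scaled_rootv k : U := scale k *: rootv k.
Local Notation X := scaled_rootv.

Lemma scaled_rootv_id k : k \notin [:: 13; 14; 15]%N -> X k = rootv k.
Proof. by move=> /negbTE hk; rewrite /scaled_rootv /scale hk scale1r. Qed.

Hypothesis factors_neq0 : forall f, f \in factors -> laurent_val r s f != 0.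

Lemma laurent_val_r_plus_s : laurent_val r s r_plus_s = r + s.
Proof.
by rewrite /laurent_val !big_cons big_nil /laurent_mono !mulr1 mul1r addr0 mul1r.
Qed.

Lemma r_plus_s_neq0 : r + s != 0.
Proof. by rewrite -laurent_val_r_plus_s factors_neq0. Qed.

Lemma scale_neq0 k : scale k != 0.
Proof. by rewrite /scale; case: ifP; rewrite ?oner_eq0 ?invr_eq0 ?r_plus_s_neq0. Qed.

Lemma scaled_simple : [/\ X 1 = gE i1, X 16 = gE i2, X 22 = gE i3 & X 24 = gE i4].
Proof. by have [<- <- <- <-] := rootv_simple; rewrite !scaled_rootv_id. Qed.

Lemma definition_rule_sound k i j : (k, i, j) \in root_pairs ->
  X i * X j = ncval r s X (definition_rule (k, i, j)).2.
Proof.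
move=> hk; rewrite ncval_cons.
have -> : ncval r s X [seq (f.1.1, (f.1.2, f.2, [:: k])) | f <- root_scale k]
    = laurent_val r s (root_scale k) *: X k.
  rewrite /ncval big_map /laurent_val scaler_suml.
  by apply: eq_bigr => f _; rewrite /term_val /word_val big_seq1.
have -> : term_val r s X (1, (chi_exp i j, [:: j; i]))
    = rs_pairing r s (beta j) (beta i) *: (X j * X i).
  by rewrite rs_pairing_beta /term_val word_val_pair /laurent_mono mul1r.
apply: scaled_commutator (rootv_pair hk) _.
(* From 13 = (12, 22), 14 = (13, 22), 15 = (14, 16): the factor 1/(r + s) enters at 13 and is passed
   on to 14 and 15 by the first members, so only the rule for 13 shows r + s. *)
have : all (fun t : nat * nat * nat => let b n := n \in [:: 13; 14; 15]%N in
  ~~ b t.2 && (b t.1.2 == (b t.1.1 && (t.1.1 != 13%N)))) root_pairs by [].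
move/allP/(_ _ hk); rewrite /scale /root_scale /= => /andP[/negbTE -> /eqP ->].
rewrite mulr1; case: eqP => [->|_] /=; last first.
  by rewrite andbT /laurent_val big_seq1 laurent_mono1 mul1r.
by rewrite laurent_val_r_plus_s divff ?r_plus_s_neq0.
Qed.

Lemma commutation_rule_sound i j : (i, j) \in [:: (1, 22); (1, 24); (16, 24)]%N ->
  X i * X j = ncval r s X (commutation_rule (i, j)).2.
Proof.
rewrite ncval_cons ncval_nil addr0 /term_val word_val_pair.
rewrite [laurent_mono _ _ _ _ _]laurent_mono1 scale1r /=.
have [e1 e16 e22 e24] := scaled_simple; rewrite !inE.
by case/or3P=> /eqP[-> ->]; rewrite ?e1 ?e16 ?e22 ?e24; apply: genEC.
Qed.

Lemma serre_polys_sound z : z \in serre_polys -> ncval r s X z = 0.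
Proof.
have [e1 e16 e22 e24] := scaled_simple.
have hs n : (n < 6)%N -> nth [::] (serre r s) n \in serre r s.
  by move=> ?; apply: mem_nth.
rewrite !inE => /or4P[/eqP->|/eqP->|/eqP->|/or3P[/eqP->|/eqP->|/eqP->]].
- exact: quadratic_serre0 e1 e16 _ _ (serreE (hs 0%N isT)).
- exact: quadratic_serre0 e16 e1 _ _ (serreE (hs 1%N isT)).
- exact: quadratic_serre0 e16 e22 _ _ (serreE (hs 2%N isT)).
- exact: cubic_serre0 e22 e16 (serreE (hs 3%N isT)).
- exact: quadratic_serre0 e22 e24 _ _ (serreE (hs 4%N isT)).
- exact: quadratic_serre0 e24 e22 _ _ (serreE (hs 5%N isT)).
Qed.

Lemma root_rules_sound : sound r s X root_rules.
Proof.
apply: sound_rules => //; last exact: serre_polys_sound.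
move=> t; rewrite mem_cat => /orP[/mapP[[[k i] j] ht ->]|/mapP[[i j] ht ->]].
  exact: definition_rule_sound.
exact: commutation_rule_sound.
Qed.

(** Combines the evaluated shape of the rules with their soundness, to feed [word_span_bound]. *)
Lemma scaled_rootv_straight i j : (0 < i)%N -> (i < j <= 24)%N ->
  exists c u, X i * X j = c *: (X j * X i) + u
    /\ word_span X 24 height i (height i + height j) u.
Proof.
move=> i_gt0 /andP[lt_ij le_j].
have hi : i \in iota 1 24 by rewrite mem_iota i_gt0 ltnS (leq_trans (ltnW lt_ij)).
have hj : j \in iota 1 24 by rewrite mem_iota (leq_trans _ lt_ij) // ltnS.
have /allP/(_ _ hi)/allP/(_ _ hj) := root_rules_straight.
rewrite lt_ij => /andP[/eqP nz ok_ij].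
have [c [u [e hu]]] := word_span_straight X r s ok_ij.
by exists c, u; split=> //; apply: etrans (root_rules_sound nz) e.
Qed.

Lemma scaled_rootv_pow k : (0 < k <= 24)%N -> X k ^+ l = 0.
Proof. by move=> hk; rewrite exprZn rootv_pow // scaler0. Qed.

Definition top_height := (l.-1 * \sum_(1 <= k < 25) height k)%N.

Lemma above_top_height n x :
  word_span X 24 height 0 n x -> (top_height < n)%N -> x = 0.
Proof.
exact: word_span_bound scaled_rootv_straight _ scaled_rootv_pow _ _ _.
Qed.

Definition top_monomial : U := \prod_(k <- rev (iota 1 24)) rootv k ^+ l.-1.

Lemma rootv_span k : (0 < k <= 24)%N -> word_span X 24 height 0 (height k) (rootv k).
Proof.
move=> hk; rewrite -[rootv k](scalerK (scale_neq0 k)).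
exact/word_spanZ/word_span_gen.
Qed.

Lemma top_monomial_span : word_span X 24 height 0 top_height top_monomial.
Proof.
(* The heights are summed in the order of the factors of x, so one induction treats both. *)
rewrite /top_height big_distrr /= (perm_big (rev (iota 1 24))) // /top_monomial.
have : all (fun k => 0 < k <= 24)%N (rev (iota 1 24)) by [].
elim: (rev _) => [_|k w IH /andP[hk hw]]; first by rewrite !big_nil; apply: word_span1.
by rewrite !big_cons; apply: word_spanM (IH hw); apply/word_spanXn/rootv_span.
Qed.

Lemma genE_rootv i :
  exists k, [/\ gE i = rootv k, (0 < k <= 24)%N & (0 < height k)%N].
Proof.
have [e1 e2 e3 e4] := rootv_simple.
have ex c k : val i = val c -> rootv k = gE c -> (0 < k <= 24)%N ->
    (0 < height k)%N ->
    exists k, [/\ gE i = rootv k, (0 < k <= 24)%N & (0 < height k)%N].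
  by move=> /val_inj -> <- ? ?; exists k.
case: i ex => [[|[|[|[|i]]]]] // hi ex.
- exact: ex i1 1%N _ e1 _ _.
- exact: ex i2 16%N _ e2 _ _.
- exact: ex i3 22%N _ e3 _ _.
- exact: ex i4 24%N _ e4 _ _.
Qed.

Lemma genE_top i : gE i * top_monomial = 0.
Proof.
have [k [-> hk h_gt0]] := genE_rootv i.
apply: above_top_height (word_spanM (rootv_span hk) top_monomial_span) _.
by rewrite -[X in (X < _)%N]add0n ltn_add2r.
Qed.

Lemma top_genE i : top_monomial * gE i = 0.
Proof.
have [k [-> hk h_gt0]] := genE_rootv i.
apply: above_top_height (word_spanM top_monomial_span (rootv_span hk)) _.
by rewrite -[X in (X < _)%N]addn0 ltn_add2l.
Qed.

Definition torus_sum : U := \prod_(i < 4) \sum_(j < l) gw i ^+ j.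

Lemma omegaC i j : gw i * gw j = gw j * gw i.
Proof. exact: torusC. Qed.

Lemma genE_torus_sum i : exists t', gE i * torus_sum = t' * gE i.
Proof.
(* As E_i omega_k = a_{ki}^{-1} omega_k E_i, passing E_i through t rescales each omega_k. *)
exists (\prod_(k < 4) \sum_(j < l) ((aa r s k i)^-1 *: gw k) ^+ j).
apply: intertwine_prod => k; apply: intertwine_geometric.
by rewrite -scalerAl omegaE scalerK ?aa_neq0.
Qed.

Lemma torus_sum_genE i : exists t', torus_sum * gE i = gE i * t'.
Proof.
exists (\prod_(k < 4) \sum_(j < l) (aa r s k i *: gw k) ^+ j).
apply/esym/intertwine_prod => k; apply: intertwine_geometric.
by rewrite -scalerAr omegaE.
Qed.

Lemma omega_torus_sum i : gw i * torus_sum = torus_sum.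
Proof.
apply: (mulr_prod_absorb (mem_index_enum i)) => [j|].
  by apply: intertwine_geometric; apply: omegaC.
by apply: mulr_geometric (omega_pow i); apply: odd_gt0.
Qed.

Lemma torus_sum_omega i : torus_sum * gw i = torus_sum.
Proof.
rewrite -[RHS](omega_torus_sum i); apply/esym/intertwine_prod => j.
by apply: intertwine_geometric; apply: omegaC.
Qed.

(** Since omega_i is absorbed by t, it can be inserted to cancel its inverse. *)
Lemma omegaV_torus_sum i : gwV i * torus_sum = torus_sum.
Proof.
rewrite -[in LHS](omega_torus_sum i) mulrA (torusC (x := GwV i)) //.
by rewrite omegaK mul1r.
Qed.

Lemma torus_sum_omegaV i : torus_sum * gwV i = torus_sum.
Proof. by rewrite -[in LHS](torus_sum_omega i) -mulrA omegaK mulr1. Qed.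

Lemma ueps_gen x : ueps r s l_odd (ugen r s l_odd x) = (is_torus x)%:R.
Proof.
by apply: etrans (augEpsE _ _) _; apply: etrans (augEpsE _ _) _; apply: freeEval_var.
Qed.

Lemma frakb_torus_sum_top :
  frakb (torus_sum * top_monomial) /\ frakb (top_monomial * torus_sum).
Proof.
suff h : forall B : U -> Prop, subalgebra B -> contains_b_gens B ->
    B torus_sum /\ B top_monomial.
  by split; apply/frakb_subalgebra => B Bs Bg; have [Bt Bx] := h B Bs Bg;
    case: Bs => _ _ BM; apply: BM.
move=> B Bs Bg; have Bc : closed_subalgebra B := Bs; split.
  apply: closed_subalgebra_prod => // i; apply: closed_subalgebra_sum => // j.
  by apply: closed_subalgebraX => //; case: (Bg i).
apply: closed_subalgebra_prod => // k; apply: closed_subalgebraX => //.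
(* Root vectors are iterated skew commutators of the E_c, so they stay in [B]. *)
rewrite /urootE; apply: (root_family_ind (P := fun x => B (upi l_odd x)))
  => [|c|i j x y Bx By].
- by rewrite upi0; apply: closed_subalgebra0.
- by case: (Bg c).
rewrite upiB upiZ; case: (Bc) => _ _ BM.
by apply: closed_subalgebraB => //; rewrite upiM; apply: BM.
Qed.

Lemma left_integral_torus_top : left_integral (torus_sum * top_monomial).
Proof.
split=> [|a /frakb_subalgebra ha]; first by case: frakb_torus_sum_top.
apply: (ha _ (left_integrating_closed (ueps r s l_odd) _)) => {a ha}.
move=> i; split; rewrite ueps_gen mulrA ?scale1r.
- have [t' ->] := genE_torus_sum i.
  by rewrite -mulrA genE_top mulr0 scale0r.
- by rewrite omega_torus_sum.
- by rewrite omegaV_torus_sum.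
Qed.

Lemma right_integral_top_torus : right_integral (top_monomial * torus_sum).
Proof.
split=> [|a /frakb_subalgebra ha]; first by case: frakb_torus_sum_top.
apply: (ha _ (right_integrating_closed (ueps r s l_odd) _)) => {a ha}.
move=> i; split; rewrite ueps_gen -mulrA ?scale1r.
- have [t' ->] := torus_sum_genE i.
  by rewrite mulrA top_genE mul0r scale0r.
- by rewrite torus_sum_omega.
- by rewrite torus_sum_omegaV.
Qed.

End RootVectors.

(** * The denominators do not vanish at the given roots of unity; conclusion *)

Lemma factors_neq0 (K : fieldType) (r s : K) :
  r ^+ 2 != s ^+ 2 -> r ^+ 3 != s ^+ 3 -> r ^+ 2 + s ^+ 2 != 0 ->
  forall f, f \in factors -> laurent_val r s f != 0.
Proof.
move=> rs2 rs3 rs4 f; have rsB : r - s != 0.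
  by rewrite subr_eq0; apply: contra_neq rs2 => ->.
rewrite !inE => /or4P[] /eqP ->;
  rewrite /laurent_val !big_cons big_nil /laurent_mono /= addr0;
  rewrite ?expr0z ?mulr1 ?mul1r ?mulN1r -?exprnP ?expr1 //.
  by apply: contra_neq rs2 => /eqP; rewrite addr_eq0 => /eqP ->; rewrite sqrrN.
(* The factor r^2 + rs + s^2 divides r^3 - s^3. *)
apply: contra_neq rs3 => e; apply/eqP; rewrite -subr_eq0.
have -> : r ^+ 3 - s ^+ 3 = (r - s) * (r ^+ 2 + (r * s + s ^+ 2)) by ring.
by rewrite e mulr0.
Qed.

Theorem theorem7p1 (K : fieldExtType rat) (KC : {rmorphism K -> algC})
    (r s : K) (d d' l : nat)
    (r_prim : d.-primitive_root (KC r)) (s_prim : d'.-primitive_root (KC s))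
    (K_gen : <<1 & [:: r; s]>>%VS = fullv)
    (l_def : l = lcmn d d') (l_odd : odd l)
    (rs2 : r ^+ 2 != s ^+ 2) (rs3 : r ^+ 3 != s ^+ 3) :
  let t : urs r s l_odd :=
    \prod_(i < 4) \sum_(j < l) ugen r s l_odd (Gw i) ^+ j in
  let x : urs r s l_odd :=
    \prod_(k <- rev (iota 1 24)) urootE r s l_odd k ^+ l.-1 in
  left_integral (t * x) /\ right_integral (x * t).
Proof.
have l_gt0 : (0 < l)%N by apply: odd_gt0.
have pow_l n (z : K) : n.-primitive_root (KC z) -> (n %| l)%N -> z ^+ l = 1.
  move=> nz /dvdnP[m ->]; apply: (fmorph_inj KC).
  by rewrite rmorphXn mulnC exprM (prim_expr_order nz) expr1n rmorph1.
have rl : r ^+ l = 1 by apply: pow_l r_prim _; rewrite l_def dvdn_lcml.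
have sl : s ^+ l = 1 by apply: pow_l s_prim _; rewrite l_def dvdn_lcmr.
have nz (z : K) : z ^+ l = 1 -> z != 0.
  move=> zl; apply: contra_eq_neq zl => ->.
  by rewrite expr0n gtn_eqF // eq_sym oner_neq0.
have rs4 : r ^+ 2 + s ^+ 2 != 0.
  (* Raising r^2 = -s^2 to the odd power l would give 1 = -1, which is false in characteristic 0. *)
  rewrite addr_eq0; apply/eqP => /(congr1 (fun z => KC (z ^+ l))).
  rewrite exprNn -signr_odd l_odd expr1 -!exprM !(mulnC 2) !exprM rl sl !expr1n.
  rewrite mulr1 rmorphN rmorph1 => /eqP.
  by rewrite -addr_eq0 -[1 + 1]/(2%:R) pnatr_eq0.
move=> t x; have fs := factors_neq0 rs2 rs3 rs4.
split; first exact: left_integral_torus_top (nz r rl) (nz s sl) fs.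
exact: right_integral_top_torus (nz r rl) (nz s sl) fs.
Qed.
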